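(* Every negatively associated Gaussian threshold process is tail trivial. That is, let $(Z_i)_{i \in \mathbb{N}}$ be a Gaussian process, let $(a_i)_{i\in\mathbb{N}}$ be a sequence of real numbers, and let $X_i = 1_{\{Z_i \geq a_i\}}$ for all $i \in \mathbb{N}$. If $(X_i)_{i \in \mathbb{N}}$ is negatively associated, then $\mathbb{P}(E) \in \{0,1\}$ for every $E \in \bigcap_{n=1}^\infty \sigma(X_i : i \geq n)$.
   Context: A Gaussian process $(Z_i)_{i\in\mathbb{N}}$ is a sequence of random variables all of whose finite subfamilies are jointly Gaussian. A Gaussian threshold process is a process of the form $(1_{\{Z_i \geq a_i\}})_{i \in \mathbb{N}}$ with $(Z_i)_{i\in\mathbb{N}}$ a Gaussian process and $a_i \in \mathbb{R}$. A process $(X_i)_{i \in \mathbb{N}}$ is negatively associated if $\mathbb{E}[fg] \leq \mathbb{E}[f]\,\mathbb{E}[g]$ for every pair of coordinatewise increasing (i.e. nondecreasing) functions $f$ and $g$ of the process that depend on disjoint subsets of the components (and for which these expectations exist). *)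

(* Defs.v *)
From HB Require Import structures.
From mathcomp Require Import all_boot all_order all_algebra.
From mathcomp Require Import all_classical all_reals all_analysis.

Set Implicit Arguments.
Unset Strict Implicit.
Unset Printing Implicit Defensive.

Import Order.TTheory GRing.Theory Num.Theory.
Import numFieldNormedType.Exports.

Local Open Scope classical_set_scope.
Local Open Scope ring_scope.

Section gaussian.
Context d (T : measurableType d) (R : realType) (P : probability T R).

(* Degenerate Gaussians (point masses) are allowed; they are treated apart
   because [normal_prob m 0] is by convention the uniform law on [0, 1]. *)
Definition gaussian_rv (Y : T -> R) : Prop :=
  measurable_fun [set: T] Y /\
  exists m s : R, forall A : set R, measurable A ->
    pushforward P Y A = if s == 0 then \d_m A else normal_prob m s A.

Definition jointly_gaussian n (Y : 'I_n -> T -> R) : Prop :=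
  forall c : 'I_n -> R, gaussian_rv (fun w => \sum_(k < n) c k * Y k w).

Definition gaussian_process (Z : nat -> {RV P >-> R}) : Prop :=
  forall n (t : 'I_n -> nat), injective t ->
    jointly_gaussian (fun k => Z (t k) : T -> R).

Definition threshold (Z : nat -> {RV P >-> R}) (a : nat -> R) :
    nat -> T -> R :=
  fun i => \1_[set w | a i <= Z i w].

End gaussian.

Definition coord_gen (U : Type) (R : realType) (X : nat -> U -> R)
    (D : set nat) : set (set U) :=
  \bigcup_(i in D) preimage_set_system [set: U] (X i) measurable.

(* R^nat equipped with its product sigma-algebra *)
Definition seq_space (R : realType) : measurableType _ :=
  g_sigma_algebraType (coord_gen (fun i (x : nat -> R) => x i) [set: nat]).

Section negative_association.
Context (R : realType).

Definition coord_nondecreasing (f : (nat -> R) -> R) : Prop :=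
  forall x y : nat -> R, (forall i, x i <= y i) -> f x <= f y.

Definition depends_only_on (I : set nat) (f : (nat -> R) -> R) : Prop :=
  forall x y : nat -> R, (forall i, I i -> x i = y i) -> f x = f y.

Context d (T : measurableType d) (P : probability T R).

Definition negatively_associated (X : nat -> T -> R) : Prop :=
  forall (I J : set nat) (f g : (nat -> R) -> R),
    I `&` J = set0 ->
    measurable_fun [set: seq_space R] f -> measurable_fun [set: seq_space R] g ->
    coord_nondecreasing f -> coord_nondecreasing g ->
    depends_only_on I f -> depends_only_on J g ->
    let fX := fun w => f (fun i => X i w) in
    let gX := fun w => g (fun i => X i w) in
    P.-integrable [set: T] (EFin \o fX) ->
    P.-integrable [set: T] (EFin \o gX) ->
    P.-integrable [set: T] (EFin \o (fX \* gX)) ->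
    ('E_P[fX \* gX] <= 'E_P[fX] * 'E_P[gX])%E.

Definition tail_sigma_algebra (X : nat -> T -> R) : set (set T) :=
  \bigcap_n <<s coord_gen X [set i | (n <= i)%N] >>.

Definition tail_trivial (X : nat -> T -> R) : Prop :=
  forall E : set T, tail_sigma_algebra X E -> P E = 0%E \/ P E = 1%E.

End negative_association.

(* Main.v *)
(** Negative association forces the covariances of the Gaussian variables to be
nonpositive. If moreover [<U, v>] with [|v| <= 1] did not tend to 0 as [v]
ranges over the spans of [Z_n, Z_n+1, ...], one could stack [K] such vectors
with disjoint supports; splitting each one into its positive and its negative
part, nonpositivity of the covariances bounds the square norm of either sum by
[O(K)], while the inner product with [U] grows like [K], against
Cauchy-Schwarz. So the projections of [U] on the tail spans vanish, a tail
event is independent of [U], hence of every finite-dimensional event, hence of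
itself.

Independence is obtained from characteristic functions, one coordinate at a
time: uncorrelated linear combinations have factorizing characteristic
functions, and a bounded weight [psi] with [E(psi e^(itY)) = 0] for all [t] also
has [E(psi 1_(Y >= a)) = 0]. *)

From HB Require Import structures.
Require Import Defs.
From mathcomp Require Import all_boot all_order all_algebra.
From mathcomp Require Import all_classical all_reals all_analysis.
From mathcomp Require Import measurable_realfun zify ring lra.

Set Implicit Arguments.
Unset Strict Implicit.
Unset Printing Implicit Defensive.

Import Order.TTheory GRing.Theory Num.Theory.
Import numFieldNormedType.Exports.

Local Open Scope classical_set_scope.
Local Open Scope ring_scope.

(** * Bounded weights and Fourier uniqueness *)

Section bounded_measurable.
Context d (T : measurableType d) (R : realType) (P : probability T R).
Implicit Types f g : T -> R.

(** Only one-dimensional laws enter. A Gaussian process gives the law of each linear combination,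
    and facts about several coordinates are read off from the characteristic functions of [p + q]
    and [p - q]. No joint density appears, so degenerate combinations cause no trouble, except where
    a probability must be strictly between 0 and 1.

    The sign of the covariances comes from a comparison. If [p] and [q] are positively correlated,
    then [q] is a positive multiple of [p] plus an independent remainder, so its threshold event
    gains probability as [p] grows. Negative association would force the reverse inequality on both
    sides of the level of [p], although this probability tends to 1 on one side and to 0 on the
    other.

    In the stacking argument, nonpositive covariances control only combinations with nonnegative
    coefficients, while projections have both signs: hence the two parts are accumulated separately
    and meet again only in the inner product with [U].

    The order of quantifiers matters at the end: a start [n] of the tail serves all windows from [n]
    on, so the window can be fitted afterwards to the event that is approximated. *)

Definition bmeas f :=
  measurable_fun [set: T] f /\ exists M : R, forall x, `|f x| <= M.

Lemma bmeas_cst (k : R) : bmeas (fun=> k).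
Proof. by split=> //; exists `|k|. Qed.

Lemma bmeasD f g : bmeas f -> bmeas g -> bmeas (fun x => f x + g x).
Proof.
move=> [mf [M fM]] [mg [N gN]]; split; first exact: measurable_funD.
by exists (M + N) => x; rewrite (le_trans (ler_normD _ _))// lerD.
Qed.

Lemma bmeasM f g : bmeas f -> bmeas g -> bmeas (fun x => f x * g x).
Proof.
move=> [mf [M fM]] [mg [N gN]]; split; first exact: measurable_funM.
by exists (M * N) => x; rewrite normrM ler_pM.
Qed.

Lemma bmeasN f : bmeas f -> bmeas (fun x => - f x).
Proof.
move=> [mf [M fM]]; split; first exact: measurableT_comp.
by exists M => x; rewrite normrN.
Qed.

Lemma bmeasB f g : bmeas f -> bmeas g -> bmeas (fun x => f x - g x).
Proof. by move=> bf /bmeasN; exact: bmeasD. Qed.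

Lemma bmeas_indic (A : set T) : measurable A -> bmeas (\1_A : T -> R).
Proof.
move=> mA; split; first exact: measurable_indic.
by exists 1 => x; rewrite indicE; case: (_ \in _); rewrite ?normr1// normr0.
Qed.

Lemma bmeas_cos f : measurable_fun [set: T] f -> bmeas (fun x => cos (f x)).
Proof.
move=> mf; split; last by exists 1 => x; exact: cos_max.
apply: (measurableT_comp _ mf); apply: continuous_measurable_fun.
exact: continuous_cos.
Qed.

Lemma bmeas_sin f : measurable_fun [set: T] f -> bmeas (fun x => sin (f x)).
Proof.
move=> mf; split; last by exists 1 => x; exact: sin_max.
apply: (measurableT_comp _ mf); apply: continuous_measurable_fun.
exact: continuous_sin.
Qed.

Lemma bmeas_norm f : bmeas f -> bmeas (fun x => `|f x|).
Proof.
move=> [mf [M fM]]; split; first exact: measurableT_comp.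
by exists M => x; rewrite normr_id.
Qed.

Lemma bmeas_integrable f : bmeas f -> P.-integrable [set: T] (EFin \o f).
Proof.
move=> [mf [M fM]]; apply: measurable_bounded_integrable => //.
  by rewrite -ge0_fin_numE// fin_num_measure.
exists M; split => [|y My x _]; first exact: num_real.
by rewrite /= (le_trans (fM x))// ltW.
Qed.

Lemma Rintegral_bmeasD f g : bmeas f -> bmeas g ->
  \int[P]_x (f x + g x) = \int[P]_x f x + \int[P]_x g x.
Proof. by move=> bf bg; rewrite RintegralD//; exact: bmeas_integrable. Qed.

Lemma Rintegral_bmeasB f g : bmeas f -> bmeas g ->
  \int[P]_x (f x - g x) = \int[P]_x f x - \int[P]_x g x.
Proof. by move=> bf bg; rewrite RintegralB//; exact: bmeas_integrable. Qed.

Lemma Rintegral_bmeasZ (k : R) f : bmeas f ->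
  \int[P]_x (k * f x) = k * \int[P]_x f x.
Proof. by move=> bf; rewrite RintegralZl//; exact: bmeas_integrable. Qed.

Lemma Rintegral_bmeas_le f g : bmeas f -> bmeas g -> (forall x, f x <= g x) ->
  \int[P]_x f x <= \int[P]_x g x.
Proof. by move=> bf bg fg; apply: le_Rintegral => //; exact: bmeas_integrable. Qed.

Lemma Rintegral_prob_cst (k : R) : \int[P]_x k = k.
Proof.
rewrite Rintegral_cst// -[RHS]mulr1; congr (_ * _).
exact: (congr1 fine (probability_setT P)).
Qed.

Lemma Rintegral_indicE (A : set T) : measurable A ->
  \int[P]_x (\1_A x) = fine (P A).
Proof.
by move=> mA; rewrite /Rintegral integral_indic// setIT.
Qed.

Lemma cvg_Rintegral_bmeas (M : R) (f_ : nat -> T -> R) f :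
  (forall n, measurable_fun [set: T] (f_ n)) -> (forall n x, `|f_ n x| <= M) ->
  (forall x, f_ n x @[n --> \oo] --> f x) ->
  \int[P]_x f_ n x @[n --> \oo] --> \int[P]_x f x.
Proof.
move=> mf fM cf.
have mf' : measurable_fun [set: T] f.
  by apply: (measurable_fun_cvg (h := f_)) => // x _; exact: cf.
have [|||||_ _] := @dominated_convergence _ _ _ P _ measurableT
  (fun n x => (f_ n x)%:E) (EFin \o f) (cst M%:E).
- by move=> n; exact/measurable_EFinP.
- exact/measurable_EFinP.
- by apply: aeW => x _; apply: cvg_EFin; [exact: nearW|exact: cf].
- exact: bmeas_integrable (bmeas_cst M).
- by apply: aeW => x n _ /=; rewrite lee_fin.
move=> cI; apply: fine_cvg; rewrite fineK//.
apply: integrable_fin_num => //; apply: bmeas_integrable; split => //.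
by exists M => x; apply: cvgr_to_le (cvg_norm (cf x)) _; exact: nearW.
Qed.

(** Dominated convergence. This carries orthogonality to [psi] from trigonometric polynomials to
    indicators. *)
Lemma Rintegral_mul_lim0 (psi : T -> R) (M : R) (g_ : nat -> T -> R) g :
  bmeas psi ->
  (forall n, measurable_fun [set: T] (g_ n)) -> (forall n x, `|g_ n x| <= M) ->
  (forall x, g_ n x @[n --> \oo] --> g x) ->
  (forall n, \int[P]_x (psi x * g_ n x) = 0) -> \int[P]_x (psi x * g x) = 0.
Proof.
move=> [mpsi [N psiN]] mg gM cg g0.
have : \int[P]_x (psi x * g_ n x) @[n --> \oo] --> \int[P]_x (psi x * g x).
  apply: (@cvg_Rintegral_bmeas (N * M)) => [n|n x|x].
  - exact: measurable_funM.
  - by rewrite normrM ler_pM.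
  - by apply: cvgMl_tmp; exact: cg.
under eq_fun do rewrite g0.
by move=> /(cvg_unique (@norm_hausdorff _ _)); apply; exact: cvg_cst.
Qed.

End bounded_measurable.

Ltac solve_bmeas := lazymatch goal with |- bmeas _ =>
  first [solve [auto] | first [apply: bmeasM | apply: bmeasB | apply: bmeasD];
    solve_bmeas] end.

(** * Polynomials converging pointwise to a step *)

Section step_polynomial.
Context (R : realType).
Implicit Types (q x y : R) (n : nat).

Lemma bernoulli_ineq n x : -1 <= x -> 1 + n%:R * x <= (1 + x) ^+ n.
Proof.
move=> x1; elim: n => [|n ih]; first by rewrite mul0r addr0 expr0.
rewrite exprS -natr1; have n0 : 0 <= n%:R * x ^+ 2 by rewrite mulr_ge0// sqr_ge0.
have : (1 + x) * (1 + n%:R * x) <= (1 + x) * (1 + x) ^+ n.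
  by rewrite ler_wpM2l//; lra.
by apply: le_trans; rewrite -subr_ge0; move: n0; congr (0 <= _); ring.
Qed.

(** With [x = y ^ 2], half of the power absorbs the factor [n]: [n * y ^ n] is at most the geometric
    sum of the [y ^ i], hence at most [1 / (1 - y)], and the other [y ^ n] tends to 0. *)
Lemma cvg_natr_expr x : 0 <= x < 1 -> n%:R * x ^+ n @[n --> \oo] --> (0 : R).
Proof.
move=> /andP[x0 x1]; pose y := Num.sqrt x.
have xE : x = y ^+ 2 by rewrite sqr_sqrtr.
have y0 : 0 <= y by exact: sqrtr_ge0.
have y1 : y < 1 by rewrite -sqrtr1 ltr_sqrt.
apply: (@squeeze_cvgr _ _ _ _ (fun=> 0) (fun n => (1 - y)^-1 * y ^+ n)).
- near=> n; rewrite mulr_ge0 ?exprn_ge0//= xE -exprM mul2n -addnn exprD mulrA.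
  apply: ler_wpM2r; first exact: exprn_ge0.
  rewrite -[leRHS]mul1r ler_pdivlMr ?subr_gt0//.
  have : n%:R * y ^+ n <= \sum_(i < n) y ^+ i.
    have -> : n%:R * y ^+ n = \sum_(i < n) y ^+ n.
      by rewrite sumr_const card_ord mulr_natl.
    apply: ler_sum => i _.
    by apply: ler_wiXn2l; rewrite ?(ltW y1) ?(ltnW (ltn_ord i)).
  move=> /(ler_wpM2r (ltW (eqbRL (subr_gt0 _ _) y1))) /le_trans; apply.
  by rewrite mulrC -opprB mulNr -subrX1 opprB lerBlDr lerDl exprn_ge0.
- exact: cvg_cst.
- rewrite -(mulr0 (1 - y)^-1); apply: cvgMl_tmp; apply: cvg_expr.
  by rewrite ger0_norm.
Unshelve. all: by end_near. Qed.

(* The factor [n] in the exponent makes the limit 0, and not 1/e, at [q = 1/2]. *)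
Definition steep n q : R := (1 - q ^+ n) ^+ (n * 2 ^ n).

Lemma steep_itv n q : 0 <= q <= 1 -> 0 <= steep n q <= 1.
Proof.
move=> /andP[q0 q1]; have qn : 0 <= 1 - q ^+ n <= 1.
  by rewrite subr_ge0 exprn_ile1//= lerBlDr lerDl exprn_ge0.
by move: qn => /andP[? ?]; rewrite /steep exprn_ge0//= exprn_ile1.
Qed.

(** Bernoulli's inequality on both sides. Below 1/2 it gives [1 - steep n q <= n * (2 * q) ^ n],
    which tends to 0. From 1/2 on, the product of [steep n q] and [(1 + q ^ n) ^ (n * 2 ^ n)] is at
    most 1, and the second factor is at least [n + 1]. *)
Lemma cvg_steep q : 0 <= q <= 1 ->
  steep n q @[n --> \oo] --> (if q < 2^-1 then 1 else 0 : R).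
Proof.
move=> q01; have /andP[q0 q1] := q01.
have Xn0 n : 0 <= q ^+ n by exact: exprn_ge0.
have Xn1 n : q ^+ n <= 1 by exact: exprn_ile1.
have ME n : (n * 2 ^ n)%:R * q ^+ n = n%:R * (2 * q) ^+ n :> R.
  by rewrite natrM natrX exprMn mulrA.
case: ifPn => [q2|]; last rewrite -leNgt => q2.
- apply: (@squeeze_cvgr _ _ _ _ (fun n => 1 - n%:R * (2 * q) ^+ n) (fun=> 1)).
  + near=> n; have /andP[_ ->] := steep_itv n q01; rewrite andbT.
    have := @bernoulli_ineq (n * 2 ^ n) (- q ^+ n); rewrite mulrN ME; apply.
    by rewrite lerN2.
  + rewrite -[X in _ --> X]subr0; apply: cvgB; first exact: cvg_cst.
    apply: cvg_natr_expr; rewrite mulr_ge0//=.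
    by rewrite mulrC -ltr_pdivlMr// mul1r.
  + exact: cvg_cst.
- apply: (@squeeze_cvgr _ _ _ _ (fun=> 0) (fun n => (n.+1%:R)^-1)); last 2 first.
  + exact: cvg_cst.
  + exact: cvg_harmonic.
  near=> n; have /andP[-> _]/= := steep_itv n q01.
  rewrite -[leRHS]mul1r ler_pdivlMr//.
  apply: (@le_trans _ _ (steep n q * (1 + q ^+ n) ^+ (n * 2 ^ n))).
    apply: ler_wpM2l; first by have /andP[] := steep_itv n q01.
    have := @bernoulli_ineq (n * 2 ^ n) (q ^+ n); rewrite ME.
    have N1 : -1 <= q ^+ n by rewrite (le_trans _ (Xn0 n)).
    move=> /(_ N1); apply: le_trans.
    rewrite -natr1 addrC lerD2l ler_peMr// exprn_ege1//.
    by rewrite mulrC -ler_pdivrMr// mul1r.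
  rewrite -exprMn exprn_ile1//; first by rewrite mulr_ge0// ?subr_ge0// addr_ge0.
  by rewrite -subr_sqr expr1n lerBlDr lerDl sqr_ge0.
Unshelve. all: by end_near. Qed.

End step_polynomial.

Section measurable_level_sets.
Context d (T : measurableType d) (R : realType).

Lemma measurable_lt_set (f : T -> R) a : measurable_fun [set: T] f ->
  measurable [set x | f x < a].
Proof.
move=> mf; rewrite (_ : [set x | _] = [set: T] `&` f @^-1` `]-oo, a[).
  exact: mf.
by rewrite setTI; apply/seteqP; split=> x /=; rewrite in_itv.
Qed.

Lemma measurable_gt_set (f : T -> R) a : measurable_fun [set: T] f ->
  measurable [set x | a < f x].
Proof.
move=> mf; rewrite (_ : [set x | _] = [set: T] `&` f @^-1` `]a, +oo[).
  exact: mf.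
by rewrite setTI; apply/seteqP; split=> x /=; rewrite in_itv/= andbT.
Qed.

Lemma measurable_ge_set (f : T -> R) a : measurable_fun [set: T] f ->
  measurable [set x | a <= f x].
Proof.
move=> mf; rewrite (_ : [set x | _] = ~` [set x | f x < a]).
  exact/measurableC/measurable_lt_set.
by apply/seteqP; split=> x /=; rewrite leNgt => /negP.
Qed.

Lemma indic_boolE (b : T -> bool) x : \1_[set y | b y] x = (b x)%:R :> R.
Proof.
rewrite indicE; case: (boolP (b x)) => bx; first by rewrite mem_set.
by rewrite memNset//=; exact/negP.
Qed.

End measurable_level_sets.

Section trigonometric_test_functions.
Context d (T : measurableType d) (R : realType) (P : probability T R).

(* The real form of [E(psi e^(iY)) = 0]. *)
Definition trig_orth (psi Y : T -> R) :=
  \int[P]_x (psi x * cos (Y x)) = 0 /\ \int[P]_x (psi x * sin (Y x)) = 0.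

Lemma bmeas_horner (p : {poly R}) (f : T -> R) :
  bmeas f -> bmeas (fun x => p.[f x]).
Proof.
move=> bf; elim/poly_ind: p => [|p c ih].
  by under eq_fun do rewrite horner0; exact: bmeas_cst.
under eq_fun do rewrite hornerMXaddC.
by apply: bmeasD; [exact: bmeasM|exact: bmeas_cst].
Qed.

Variables psi Y : T -> R.
Hypotheses (bpsi : bmeas psi) (mY : measurable_fun [set: T] Y).
Hypothesis psiY : forall t, trig_orth psi (fun x => t * Y x).

Let mtY t c : measurable_fun [set: T] (fun x => t * Y x + c).
Proof. by apply: measurable_funD => //; exact: measurable_funM. Qed.

Let bcos t c : bmeas (fun x => cos (t * Y x + c)).
Proof. exact: bmeas_cos. Qed.

Let mtY0 t : measurable_fun [set: T] (fun x => t * Y x).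
Proof. exact: measurable_funM. Qed.

Lemma trig_orth_cosD t c : \int[P]_x (psi x * cos (t * Y x + c)) = 0.
Proof.
have [hc hs] := psiY t.
under eq_Rintegral.
  move=> x _.
  rewrite (_ : psi x * _ =
    cos c * (psi x * cos (t * Y x)) - sin c * (psi x * sin (t * Y x))); last first.
    by rewrite cosD; ring.
  over.
rewrite Rintegral_bmeasB; last 2 first.
- by apply: bmeasM; [exact: bmeas_cst|apply: bmeasM => //; exact: bmeas_cos].
- by apply: bmeasM; [exact: bmeas_cst|apply: bmeasM => //; exact: bmeas_sin].
rewrite !Rintegral_bmeasZ ?hc ?hs ?mulr0 ?subr0//.
- by apply: bmeasM => //; exact: bmeas_sin.
- by apply: bmeasM => //; exact: bmeas_cos.
Qed.

(** The extra factor of arbitrary frequency [u] and phase [e] makes the induction close: one more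
    factor [cos (t * Y + c)] is absorbed into it by the product-to-sum formula, at the frequencies
    [t + u] and [t - u]. *)
Lemma trig_orth_horner (p : {poly R}) t c u e :
  \int[P]_x (psi x * (p.[cos (t * Y x + c)] * cos (u * Y x + e))) = 0.
Proof.
elim/poly_ind: p u e => [|p a ih] u e.
  under eq_Rintegral do rewrite horner0 mul0r mulr0.
  by rewrite Rintegral_prob_cst.
under eq_Rintegral.
  move=> x _.
  rewrite (_ : psi x * _ =
    2^-1 * (psi x * (p.[cos (t * Y x + c)] * cos ((t + u) * Y x + (c + e)))) +
    2^-1 * (psi x * (p.[cos (t * Y x + c)] * cos ((t - u) * Y x + (c - e)))) +
    a * (psi x * cos (u * Y x + e))); last first.
    have eD : (t + u) * Y x + (c + e) = (t * Y x + c) + (u * Y x + e) by ring.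
    have eB : (t - u) * Y x + (c - e) = (t * Y x + c) - (u * Y x + e) by ring.
    rewrite hornerMXaddC eD eB; move: (t * Y x + c) (u * Y x + e) => y z.
    by rewrite cosD cosB; field.
  over.
have bp v w : bmeas (fun x => psi x * (p.[cos (t * Y x + c)] * cos (v * Y x + w))).
  by apply: bmeasM => //; apply: bmeasM => //; exact: bmeas_horner.
have bq : bmeas (fun x => psi x * cos (u * Y x + e)) by exact: bmeasM.
have bZ (k : R) f : bmeas f -> bmeas (fun x : T => k * f x).
  by apply: bmeasM; exact: bmeas_cst.
rewrite !Rintegral_bmeasD; [|by apply: bZ..|by apply: bmeasD; apply: bZ|by apply: bZ].
by rewrite !Rintegral_bmeasZ// !ih trig_orth_cosD !mulr0 !addr0.
Qed.

Lemma trig_orth_cos_lt t c k : -1 <= k <= 1 ->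
  \int[P]_x (psi x * \1_[set x | cos (t * Y x + c) < k] x) = 0.
Proof.
move=> /andP[k0 k1].
(* The affine map [y |-> 1/2 + (y - k) / 4] sends [-1, 1] into [0, 1] and [k] to 1/2, where the
   limit of [steep] jumps. *)
pose q n : {poly R} :=
  (1 - ((2^-1)%:P + 4^-1 *: ('X - k%:P)) ^+ n) ^+ (n * 2 ^ n).
have qE n y : (q n).[y] = steep n (2^-1 + 4^-1 * (y - k)).
  by rewrite /q /steep !(hornerE, horner_exp).
have v01 x : 0 <= 2^-1 + 4^-1 * (cos (t * Y x + c) - k) <= 1.
  by have := cos_geN1 (t * Y x + c); have := cos_le1 (t * Y x + c); lra.
apply: (@Rintegral_mul_lim0 _ _ _ _ _ 1
  (fun n x => (q n).[cos (t * Y x + c)])) => // [n|n x|x|n].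
- by have [] := bmeas_horner (q n) (bcos t c).
- by rewrite qE; have /andP[s0 s1] := steep_itv n (v01 x); rewrite ger0_norm.
- under eq_fun do rewrite qE.
  have -> : \1_[set x | cos (t * Y x + c) < k] x =
      if 2^-1 + 4^-1 * (cos (t * Y x + c) - k) < 2^-1 then 1 else 0 :> R.
    by rewrite indic_boolE gtrDl pmulr_rlt0// subr_lt0; case: ltP.
  exact: cvg_steep.
- rewrite -[RHS](trig_orth_horner (q n) t c 0 0); apply: eq_Rintegral => x _.
  by rewrite mul0r addr0 cos0 mulr1.
Qed.

(* At low frequency, [cos ((Y - c) / n) < cos (r / n)] means [r < |Y - c|]. *)
Lemma trig_orth_dist_gt c r : 0 < r ->
  \int[P]_x (psi x * \1_[set x | r < `|Y x - c|] x) = 0.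
Proof.
move=> r0.
pose A n := [set x | cos (n.+1%:R^-1 * Y x + - (n.+1%:R^-1 * c)) <
  cos (n.+1%:R^-1 * r)].
have mA n : measurable (A n).
  by apply: measurable_lt_set; have [] := bcos n.+1%:R^-1 (- (n.+1%:R^-1 * c)).
apply: (@Rintegral_mul_lim0 _ _ _ _ _ 1 (fun n => \1_(A n))) => // [n x|x|n].
- by rewrite indicE; case: (_ \in _); rewrite ?normr1// normr0.
(* For large [n] both [r / (n + 1)] and [|Y x - c| / (n + 1)] lie in [0, pi], where the cosine is
   decreasing. *)
- apply: cvg_near_cst; near=> n.
  have n0 : (0 : R) < n.+1%:R^-1 by rewrite invr_gt0.
  have pin : n%:R < pi * n.+1%:R :> R.
    rewrite (@lt_le_trans _ _ n.+1%:R) ?ltr_nat// ler_peMl// (le_trans _ (pi_ge2 R))//.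
    by rewrite ler1n.
  have small y : 0 <= y -> y < pi * n.+1%:R -> n.+1%:R^-1 * y \in `[0, pi].
    move=> y0 yn; rewrite in_itv/= mulr_ge0 ?(ltW n0)//=.
    by rewrite mulrC ler_pdivrMr// ltW.
  rewrite /A !indic_boolE -mulrN -mulrDr -[in LHS]cos_norm normrM gtr0_norm//.
  rewrite ltr_cos ?ltr_pM2l//; apply: small; rewrite ?(ltW r0)//.
  + by rewrite (lt_trans _ pin)//; near: n; exact: nbhs_infty_gtr.
  + by rewrite (lt_trans _ pin)//; near: n; exact: nbhs_infty_gtr.
- by apply: trig_orth_cos_lt; rewrite cos_geN1 cos_le1.
Unshelve. all: by end_near. Qed.

(** A half-line is the limit of complements of balls through [a]: with [N = n + 1],
    [N < |Y - (a + N)|] means [Y < a] or [Y > a + 2 * N], and the second alternative eventually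
    fails. *)
Lemma trig_orth_lt a : \int[P]_x (psi x * \1_[set x | Y x < a] x) = 0.
Proof.
apply: (@Rintegral_mul_lim0 _ _ _ _ _ 1
  (fun n => \1_[set x | n.+1%:R < `|Y x - (a + n.+1%:R)|])) => // [n|n x|x|n].
- apply/measurable_indic/measurable_gt_set; apply: measurableT_comp => //.
  exact: measurable_funB.
- by rewrite indicE; case: (_ \in _); rewrite ?normr1// normr0.
- apply: cvg_near_cst; near=> n.
  have Yn : Y x - a < n%:R by near: n; exact: nbhs_infty_gtr.
  rewrite !indic_boolE -natr1; congr ((nat_of_bool _)%:R).
  have n0 : 0 <= n%:R :> R by [].
  by apply/idP/idP => h; move: (h); rewrite ltr_normr => *; lra.
- exact: trig_orth_dist_gt.
Unshelve. all: by end_near. Qed.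

Lemma trig_orth_ge a : \int[P]_x (psi x * \1_[set x | a <= Y x] x) = 0.
Proof.
have mA : measurable [set x | Y x < a] by exact: measurable_lt_set.
under eq_Rintegral.
  move=> x _.
  (* Writing 1 as the cosine at frequency 0 lets the hypothesis [psiY 0] show that [psi] itself has
     integral 0. *)
  rewrite (_ : psi x * _ = psi x * cos (0 * Y x) - psi x * \1_[set x | Y x < a] x); last first.
    rewrite mul0r cos0 mulr1 -{2}[psi x]mulr1 -mulrBr !indic_boolE; congr (_ * _).
    by case: ltP; rewrite ?subrr ?subr0.
  over.
rewrite Rintegral_bmeasB ?trig_orth_lt ?subr0; first by have [] := psiY 0.
- by apply: bmeasM => //; exact: bmeas_cos.
- by apply: bmeasM => //; exact: bmeas_indic.
Qed.

End trigonometric_test_functions.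

(* Polynomials serve as finitely supported coefficient sequences: [lin p] is the
   linear combination of the [Z i] with coefficients [p`_i]. *)
Section linear_combination.
Context (R : realType) (U : Type) (Z : nat -> U -> R).
Implicit Types p q : {poly R}.

Definition lin p : U -> R := fun w => \sum_(i < size p) p`_i * Z i w.

Lemma lin_widen p N w : (size p <= N)%N -> lin p w = \sum_(i < N) p`_i * Z i w.
Proof.
move=> pN; rewrite /lin (big_ord_widen N (fun i => p`_i * Z i w))// big_mkcond/=.
apply: eq_bigr => i _; case: ltnP => // pi.
by rewrite nth_default ?mul0r.
Qed.

Lemma linD p q w : lin (p + q) w = lin p w + lin q w.
Proof.
pose N := maxn (size p) (size q).
rewrite (lin_widen w (size_polyD p q)) (@lin_widen p N) ?leq_maxl//.
rewrite (@lin_widen q N) ?leq_maxr// -big_split/=.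
by apply: eq_bigr => i _; rewrite coefD mulrDl.
Qed.

Lemma linZ c p w : lin (c *: p) w = c * lin p w.
Proof.
rewrite (lin_widen w (size_scale_leq c p)) /lin mulr_sumr.
by apply: eq_bigr => i _; rewrite coefZ mulrA.
Qed.

Lemma linN p w : lin (- p) w = - lin p w.
Proof. by rewrite -scaleN1r linZ mulN1r. Qed.

Lemma linB p q w : lin (p - q) w = lin p w - lin q w.
Proof. by rewrite linD linN. Qed.

Lemma lin0 w : lin 0 w = 0.
Proof. by rewrite -(scale0r 0) linZ mul0r. Qed.

Lemma linXn n w : lin 'X^n w = Z n w.
Proof.
rewrite /lin size_polyXn big_ord_recr/= coefXn eqxx mul1r big1 ?add0r// => i _.
by rewrite coefXn (ltn_eqF (ltn_ord i)) mul0r.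
Qed.

End linear_combination.

Definition supported (R : realType) (n N : nat) (p : {poly R}) :=
  forall i, ~~ (n <= i < N)%N -> p`_i = 0.

(** * Events determined by finitely many thresholds *)

Section finite_dimensional_events.
Context d (T : measurableType d) (R : realType) (P : probability T R).
Variables (Z : nat -> T -> R) (a : nat -> R).
Hypothesis mZ : forall i, measurable_fun [set: T] (Z i).

Definition bdepends (n N : nat) (B : (nat -> bool) -> bool) :=
  forall b b' : nat -> bool,
    (forall i, (n <= i < N)%N -> b i = b' i) -> B b = B b'.

(** Coding by a predicate on bit sequences makes it easy to condition on one coordinate: fixing a
    bit of [B] gives another such event, with a shorter window if the bit is the first one. *)
Definition tevent (B : (nat -> bool) -> bool) : set T :=
  [set w | B (fun i => a i <= Z i w)].

Lemma measurable_lin p : measurable_fun [set: T] (lin Z p).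
Proof. by apply: measurable_sum => i; exact: measurable_funM. Qed.

Let set_coord n c (b : nat -> bool) := fun i => if i == n then c else b i.

Let bdepends_set_coord n k B c : bdepends n (n + k.+1) B ->
  bdepends n.+1 (n.+1 + k) (fun b => B (set_coord n c b)).
Proof.
move=> hB b b' bb'; apply: hB => i ink; rewrite /set_coord.
by case: eqVneq => // ni; apply: bb'; lia.
Qed.

Let tevent_split n B w :
  (tevent B w : Prop) <->
  if a n <= Z n w then tevent (fun b => B (set_coord n true b)) w
  else tevent (fun b => B (set_coord n false b)) w.
Proof.
rewrite /tevent/=; set b := fun i => _.
have E c : a n <= Z n w = c -> b = set_coord n c b.
  move=> h; apply/funext => i; rewrite /set_coord; case: eqVneq => // ->.
  by rewrite /b h.
by case: ifPn => [|/negbTE] h; rewrite -(E _ h).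
Qed.

Lemma measurable_tevent n N B : bdepends n N B -> measurable (tevent B).
Proof.
have [nN|Nn] := leqP n N; last first.
  move=> hB; rewrite (_ : tevent B = [set w | B (fun=> false)]).
    by case: (B _); rewrite ?set_true ?set_false.
  apply/seteqP; split=> w; rewrite /tevent/=;
    by rewrite (hB (fun i => a i <= Z i w) (fun=> false))// => i; lia.
rewrite -(subnKC nN); move: (N - n)%N => k {N nN}.
elim: k n B => [|k ih] n B hB.
  rewrite (_ : tevent B = [set w | B (fun=> false)]).
    by case: (B _); rewrite ?set_true ?set_false.
  apply/seteqP; split=> w; rewrite /tevent/=;
    by rewrite (hB (fun i => a i <= Z i w) (fun=> false))// => i; lia.
pose A := [set w | a n <= Z n w].
have mA : measurable A by exact: measurable_ge_set.
rewrite (_ : tevent B = (A `&` tevent (fun b => B (set_coord n true b))) `|`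
  (~` A `&` tevent (fun b => B (set_coord n false b)))).
  by apply: measurableU; apply: measurableI; (try exact: measurableC) => //;
    apply: ih; exact: bdepends_set_coord.
apply/seteqP; split=> w.
  by move/(tevent_split n); case: ifPn => [h|/negP h] ?; [left|right].
move=> h; apply/(tevent_split n); rewrite /A in h.
by case: ifPn => [|/negP] h'; case: h => -[].
Qed.

(** The four products of a sine or cosine of [U] with one of [V] are half sums or differences of
    functions of [U + V] and [U - V]. So a trigonometric function of [U] can be moved into the
    weight, which leaves [V] alone for Fourier uniqueness. *)
Lemma trig_orth_mul (psi U V : T -> R) : bmeas psi ->
  measurable_fun [set: T] U -> measurable_fun [set: T] V ->
  trig_orth P psi (fun x => U x + V x) -> trig_orth P psi (fun x => U x - V x) ->
  trig_orth P (fun x => psi x * cos (U x)) V /\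
  trig_orth P (fun x => psi x * sin (U x)) V.
Proof.
move=> bpsi mU mV [c1 s1] [c2 s2].
have mD : measurable_fun [set: T] (fun x => U x + V x) by exact: measurable_funD.
have mB : measurable_fun [set: T] (fun x => U x - V x) by exact: measurable_funB.
have bc f : measurable_fun [set: T] f -> bmeas (fun x => psi x * cos (f x)).
  by move=> mf; apply: bmeasM => //; exact: bmeas_cos.
have bs f : measurable_fun [set: T] f -> bmeas (fun x => psi x * sin (f x)).
  by move=> mf; apply: bmeasM => //; exact: bmeas_sin.
have key (h f g : T -> R) (k : R) : bmeas f -> bmeas g ->
    \int[P]_x f x = 0 -> \int[P]_x g x = 0 ->
    (forall x, h x = 2^-1 * f x + k * g x) -> \int[P]_x h x = 0.
  move=> bf bg f0 g0 hE; under eq_Rintegral do rewrite hE.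
  have bZ (l : R) u : bmeas u -> bmeas (fun x : T => l * u x).
    by apply: bmeasM; exact: bmeas_cst.
  rewrite Rintegral_bmeasD; [|exact: bZ..].
  by rewrite !Rintegral_bmeasZ// f0 g0 !mulr0 addr0.
split; split.
- apply: (key _ _ _ (2^-1) (bc _ mD) (bc _ mB) c1 c2) => x.
  by rewrite cosD cosB; field.
- apply: (key _ _ _ (- 2^-1) (bs _ mD) (bs _ mB) s1 s2) => x.
  by rewrite sinD sinB; field.
- apply: (key _ _ _ (2^-1) (bs _ mD) (bs _ mB) s1 s2) => x.
  by rewrite sinD sinB; field.
- apply: (key _ _ _ (- 2^-1) (bc _ mB) (bc _ mD) c2 c1) => x.
  by rewrite cosB cosD; field.
Qed.

(* Fourier uniqueness one coordinate at a time: the indicator of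
   [a n <= Z n] is absorbed into the weight [psi]. *)
Lemma trig_orth_tevent n N (psi : T -> R) B : bmeas psi ->
  (forall p, supported n N p -> trig_orth P psi (lin Z p)) -> bdepends n N B ->
  \int[P]_x (psi x * \1_(tevent B) x) = 0.
Proof.
move=> bpsi hpsi hB.
(* If [N < n] the window is empty, and [n] may replace [N]; the induction is then on the window
   length. *)
have [M [nM hpsiM hBM]] : exists M, [/\ (n <= M)%N,
  (forall p, supported n M p -> trig_orth P psi (lin Z p)) & bdepends n M B].
  have [nN|Nn] := leqP n N; first by exists N.
  exists n; split=> // [p hp|b b' bb'].
    by apply: hpsi => i _; apply: hp; lia.
  by apply: hB => i; lia.
move: hpsiM hBM; rewrite -(subnKC nM) => {N hB hpsi}.
move: (M - n)%N => k {M nM}.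
elim: k n psi bpsi B => [|k ih] n psi bpsi B hpsi hB.
  (* On an empty window [B] is constant, and the zero combination gives that [psi] has integral
     0. *)
  have [] := hpsi 0; first by move=> i _; rewrite coef0.
  move=> h _; rewrite (_ : tevent B = [set w | B (fun=> false)]).
    case: (B _); rewrite ?set_true ?set_false.
      rewrite -[RHS]h; apply: eq_Rintegral => x _.
      by rewrite lin0 cos0 indicE in_setT.
    under eq_Rintegral do rewrite indicE in_set0 mulr0.
    exact: Rintegral_prob_cst.
  apply/seteqP; split=> w; rewrite /tevent/=;
    by rewrite (hB (fun i => a i <= Z i w) (fun=> false))// => i; lia.
pose A := [set w | a n <= Z n w].
have mA : measurable A by exact: measurable_ge_set.
pose psi1 x := psi x * \1_A x.
have bpsi1 : bmeas psi1 by apply: bmeasM => //; exact: bmeas_indic.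
(* The weight [psi * cos (lin Z p)] is orthogonal to every multiple of [Z n], because
   [p + t *: 'X^n] and [p - t *: 'X^n] are supported in the larger window; [trig_orth_ge] then puts
   the indicator of [A] in place of these multiples. The sine is treated alike. *)
have hpsi1 p : supported n.+1 (n.+1 + k) p -> trig_orth P psi1 (lin Z p).
  move=> hp.
  have h t : trig_orth P (fun x => psi x * cos (lin Z p x)) (fun x => t * Z n x) /\
      trig_orth P (fun x => psi x * sin (lin Z p x)) (fun x => t * Z n x).
    apply: trig_orth_mul => //; first exact: measurable_lin.
    - exact: measurable_funM.
    - rewrite (_ : (fun x => _) = lin Z (p + t *: 'X^n)).
        apply: hpsi => i hi; rewrite coefD coefZ coefXn hp; last by lia.
        by rewrite (_ : i == n = false) ?mulr0 ?addr0//; lia.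
      by apply/funext => x; rewrite linD linZ linXn.
    - rewrite (_ : (fun x => _) = lin Z (p - t *: 'X^n)).
        apply: hpsi => i hi; rewrite coefB coefZ coefXn hp; last by lia.
        by rewrite (_ : i == n = false) ?mulr0 ?subr0//; lia.
      by apply/funext => x; rewrite linB linZ linXn.
  split.
    rewrite -[RHS](@trig_orth_ge _ _ _ P (fun x => psi x * cos (lin Z p x)) (Z n) _ _ _ (a n)) => //.
    - by apply: eq_Rintegral => x _; rewrite /psi1 mulrAC.
    - by apply: bmeasM => //; apply: bmeas_cos; exact: measurable_lin.
    - by move=> t; have [] := h t.
  rewrite -[RHS](@trig_orth_ge _ _ _ P (fun x => psi x * sin (lin Z p x)) (Z n) _ _ _ (a n)) => //.
  - by apply: eq_Rintegral => x _; rewrite /psi1 mulrAC.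
  - by apply: bmeasM => //; apply: bmeas_sin; exact: measurable_lin.
  - by move=> t; have [] := h t.
have hpsi' p : supported n.+1 (n.+1 + k) p -> trig_orth P psi (lin Z p).
  by move=> hp; apply: hpsi => i hi; apply: hp; lia.
pose Bc c := fun b => B (set_coord n c b).
have bB c : bdepends n.+1 (n.+1 + k) (Bc c) by exact: bdepends_set_coord.
have bI c : bmeas (\1_(tevent (Bc c)) : T -> R).
  by apply: bmeas_indic; exact: measurable_tevent (bB c).
(* Conditioning on bit [n]: the indicator of [B] is that of [Bc false] plus [\1_A] times the
   difference between those of [Bc true] and [Bc false]. The induction hypothesis applies with the
   weights [psi] and [psi1]. *)
under eq_Rintegral.
  move=> x _.
  rewrite (_ : psi x * _ = psi x * \1_(tevent (Bc false)) x +
    (psi1 x * \1_(tevent (Bc true)) x - psi1 x * \1_(tevent (Bc false)) x)); last first.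
    have -> : \1_(tevent B) x =
        if a n <= Z n x then \1_(tevent (Bc true)) x else \1_(tevent (Bc false)) x :> R.
      rewrite !indicE; have := tevent_split n B x.
      case: ifPn => _ h; congr ((nat_of_bool _)%:R);
        by apply/idP/idP => /set_mem h'; apply/mem_set; apply/h.
    by rewrite /psi1 /A indic_boolE; case: ifPn => _ /=; ring.
  over.
rewrite Rintegral_bmeasD ?Rintegral_bmeasB ?(ih n.+1 psi) ?(ih n.+1 psi1) ?subr0 ?addr0//.
all: try (by apply: bmeasM).
by apply: bmeasB; apply: bmeasM.
Qed.

End finite_dimensional_events.

(** * Gaussian laws *)

Section normal_law.
Context (R : realType) (m s : R).
Hypothesis s0 : s != 0.
Local Notation mu := (@lebesgue_measure R).
Let nu : probability (measurableTypeR R) R := normal_prob m s.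
Let f := normal_pdf m s.

Let mf : measurable_fun [set: R] f.
Proof. exact: measurable_normal_pdf. Qed.

Let f0 x : 0 <= f x.
Proof. exact: normal_pdf_ge0. Qed.

(** Both functions have integral [nu E] over each measurable [E]. This turns the change of variables
    for Radon-Nikodym derivatives into one for the explicit density. *)
Let pdf_ae_eq : ae_eq mu [set: R] (Radon_Nikodym_SigmaFinite.f nu mu) (EFin \o f).
Proof.
have numu : nu `<< mu by exact: normal_prob_dominates.
apply: integral_ae_eq => //.
- exact: Radon_Nikodym_SigmaFinite.f_integrable.
- exact/measurable_EFinP.
- by move=> E _ mE; rewrite -Radon_Nikodym_SigmaFinite.f_integral.
Qed.

Lemma ge0_integral_normal_prob (h : R -> R) : measurable_fun [set: R] h ->
  (forall x, 0 <= h x) ->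
  (\int[normal_prob m s]_x (h x)%:E = \int[mu]_x (h x * f x)%:E)%E.
Proof.
move=> mh h0.
have numu : nu `<< mu by exact: normal_prob_dominates.
have mh' : measurable_fun [set: R] (EFin \o h) by exact/measurable_EFinP.
rewrite -[LHS](Radon_Nikodym_SigmaFinite.change_of_variables numu _ measurableT mh')/=.
  apply: ae_eq_integral => //.
  - apply: emeasurable_funM => //.
    exact: measurable_int (Radon_Nikodym_SigmaFinite.f_integrable numu).
  - exact/measurable_EFinP/measurable_funM.
  - under [X in ae_eq _ _ _ X]eq_fun do rewrite EFinM.
    exact: ae_eqe_mul2l.
by move=> x; rewrite lee_fin.
Qed.

Lemma integrable_normal_prob (h : R -> R) : measurable_fun [set: R] h ->
  mu.-integrable [set: R] (fun x => (h x * f x)%:E) ->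
  (normal_prob m s).-integrable [set: R] (fun x => (h x)%:E).
Proof.
move=> mh /integrableP[_ ih]; apply/integrableP; split; first exact/measurable_EFinP.
under eq_integral do rewrite abse_EFin.
rewrite ge0_integral_normal_prob//; last exact: measurableT_comp.
by under eq_integral do rewrite -[f _]ger0_norm// -normrM -abse_EFin.
Qed.

Lemma integral_normal_prob (h : R -> R) : measurable_fun [set: R] h ->
  mu.-integrable [set: R] (fun x => (h x * f x)%:E) ->
  (\int[normal_prob m s]_x (h x)%:E = \int[mu]_x (h x * f x)%:E)%E.
Proof.
move=> mh ih.
have numu : nu `<< mu by exact: normal_prob_dominates.
have mh' : measurable_fun [set: R] (EFin \o h) by exact/measurable_EFinP.
rewrite -[LHS](Radon_Nikodym_change_of_variables numu measurableT (integrable_normal_prob mh ih))/=.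
have iRN := @Radon_Nikodym_integrable _ _ _ (charge_of_finite_measure nu) _ numu.
apply: ae_eq_integral => //.
- by apply: emeasurable_funM => //; exact: measurable_int iRN.
- exact/measurable_EFinP/measurable_funM.
- under [X in ae_eq _ _ _ X]eq_fun do rewrite EFinM.
  apply: ae_eqe_mul2l; apply: ae_eq_trans pdf_ae_eq.
  exact/ae_eq_sym/ae_eq_Radon_Nikodym_SigmaFinite.
Qed.

Let is_derive_f x : is_derive x (1 : R) f (- ((x - m) / s ^+ 2 * f x)).
Proof.
have h1 : is_derive x (1 : R) (fun y : R => y - m) 1.
  by apply: is_derive_eq; rewrite subr0.
pose c := - (s ^+ 2 *+ 2)^-1; pose p := normal_peak s.
have h2 := is_deriveZ c (is_deriveM h1 h1).
have h3 := is_deriveZ p (is_derive1_comp (is_derive_expR _) h2).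
have fE : f = (fun y : R => p * expR (c * ((y - m) * (y - m)))).
  apply/funext => y; rewrite /f normal_pdfE// /normal_fun /p /c; congr (_ * expR _).
  by rewrite !mulNr expr2 mulrC.
have := is_derive_eq h3 (erefl _); rewrite -/(is_derive _ _ _ _) fE => h4.
apply: (is_derive_eq h4); rewrite /GRing.scale/= -[c *: _]/(c * ((x - m) * (x - m))).
by rewrite /c; field.
Qed.

(** The fundamental theorem of calculus on intervals growing around [c], then dominated convergence
    with bound [|k|]. Integer radii suffice for the boundary terms. *)
Lemma Rintegral_derive_eq0 (F k : R -> R) (c : R) :
  (forall x, is_derive x (1 : R) F (k x)) -> continuous k ->
  mu.-integrable [set: R] (EFin \o k) ->
  F (c + n.+1%:R) @[n --> \oo] --> (0 : R) ->
  F (c - n.+1%:R) @[n --> \oo] --> (0 : R) ->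
  \int[mu]_x k x = 0.
Proof.
move=> dF ck ik F1 F2.
have mk : measurable_fun [set: R] k by exact: continuous_measurable_fun.
pose A n : set R := `[c - n.+1%:R, c + n.+1%:R]%classic.
have mA n : measurable (A n) by exact: measurable_itv.
have FTC n : (\int[mu]_(x in A n) (k x)%:E = (F (c + n.+1%:R) - F (c - n.+1%:R))%:E)%E.
  have cF : continuous F.
    move=> x; apply: differentiable_continuous; apply/derivable1_diffP.
    by have [] := dF x.
  have n0 : (0 : R) < n.+1%:R by [].
  rewrite (@continuous_FTC2 _ k F) ?EFinB//; first by lra.
  - exact: continuous_subspaceT.
  - split; first by move=> x _; have [] := dF x.
    + exact/cvg_at_right_filter/cF.
    + exact/cvg_at_left_filter/cF.
  - by move=> x _; rewrite derive1E; have [_ ->] := dF x.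
have [||||| _ _] := @dominated_convergence _ _ _ mu _ measurableT
  (fun n => (EFin \o k) \_ (A n)) (EFin \o k) (abse \o (EFin \o k)).
- move=> n; apply/(measurable_restrictT _ (mA n)).
  exact/measurable_funTS/measurable_EFinP.
- exact/measurable_EFinP.
- apply: aeW => x _; apply: cvg_near_cst; near=> n.
  rewrite patchE mem_set// /A/= in_itv/= -ler_distlC.
  have : `|x - c| < n%:R by near: n; exact: nbhs_infty_gtr.
  by rewrite distrC => /ltW/le_trans; apply; rewrite ler_nat.
- exact: integrable_abse.
- have bd x n : [set: R] x -> (`|((EFin \o k) \_ (A n)) x| <= (abse \o (EFin \o k)) x)%E.
    by move=> _; rewrite patchE; case: ifP => _ /=; rewrite lee_fin ?normr0.
  exact: (@aeW _ _ _ mu _ bd).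
under eq_fun => n do rewrite -integral_mkcond FTC.
rewrite -(@fineK _ (\int[mu]_x (EFin \o k) x)%E); last exact: integrable_fin_num.
move=> /fine_cvg /=; rewrite -/(Rintegral mu setT k) => cI.
have c0 : F (c + n.+1%:R) - F (c - n.+1%:R) @[n --> \oo] --> (0 : R).
  by rewrite -[X in _ --> X](subr0 0); exact: cvgB.
exact: (cvg_unique (@norm_hausdorff _ _) cI c0).
Unshelve. all: by end_near. Qed.

(** Half of the exponent pays for the square. Let [u = - (x - m) ^ 2 / (4 * s ^ 2)]: the density
    contains [expR (2 * u)], one factor [expR u] absorbs [- u] since [- u <= expR (- u)], and the
    other is a normal density with deviation [s * sqrt 2]. Second moments thus become integrable by
    comparison. *)
Let sq_pdf_le x : (x - m) ^+ 2 * f x <=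
  4 * s ^+ 2 * normal_peak s / normal_peak (s * Num.sqrt 2) *
    normal_pdf m (s * Num.sqrt 2) x.
Proof.
have p0 : normal_peak (s * Num.sqrt 2) != 0.
  by rewrite gt_eqF// normal_peak_gt0// mulf_neq0// gt_eqF// sqrtr_gt0.
rewrite /f !normal_pdfE//; last by rewrite mulf_neq0// gt_eqF// sqrtr_gt0.
rewrite [leRHS]mulrA divfK//.
have eE : - (x - m) ^+ 2 / (s ^+ 2 *+ 2) =
    - (x - m) ^+ 2 / ((s * Num.sqrt 2) ^+ 2 *+ 2) * 2.
  by rewrite exprMn sqr_sqrtr//; field.
rewrite /normal_fun eE mulr_natr mulr2n expRD.
set u := - (x - m) ^+ 2 / _.
have uE : (x - m) ^+ 2 = 4 * s ^+ 2 * - u.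
  by rewrite /u exprMn sqr_sqrtr//; field.
rewrite {1}uE [leLHS](_ : _ = (4 * s ^+ 2 * normal_peak s * expR u) * (- u * expR u)); last first.
  by ring.
have K0 : 0 <= 4 * s ^+ 2 * normal_peak s * expR u.
  by apply: mulr_ge0 (expR_ge0 _); apply: mulr_ge0 (normal_peak_ge0 _);
    apply: mulr_ge0 => //; exact: sqr_ge0.
rewrite (ler_piMr K0)//.
have -> : expR u = (expR (- u))^-1 by rewrite -expRN opprK.
rewrite ler_pdivrMr ?expR_gt0// mul1r.
by have := expR_ge1Dx (- u); lra.
Qed.

Let imf : mu.-integrable [set: R] (fun x => (f x)%:E).
Proof. exact: integrable_normal_pdf. Qed.

Let isq : mu.-integrable [set: R] (fun x => ((x - m) ^+ 2 * f x)%:E).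
Proof.
pose K := 4 * s ^+ 2 * normal_peak s / normal_peak (s * Num.sqrt 2).
apply: (@le_integrable _ _ _ mu _ measurableT _
  (fun x => (K%:E * (normal_pdf m (s * Num.sqrt 2) x)%:E)%E)).
- apply/measurable_EFinP/measurable_funM => //; apply: measurable_funX.
  exact: measurable_funB.
- move=> x _ /=; rewrite lee_fin (ger0_norm (mulr_ge0 (sqr_ge0 _) (f0 x))).
  exact: le_trans (sq_pdf_le x) (ler_norm _).
- exact: (integrableZl measurableT K (integrable_normal_pdf _ _)).
Qed.

Lemma integrable_normal_quadratic (h : R -> R) C : measurable_fun [set: R] h ->
  (forall x, `|h x| <= C * (1 + (x - m) ^+ 2)) ->
  mu.-integrable [set: R] (fun x => (h x * f x)%:E).
Proof.
move=> mh hC; apply: (@le_integrable _ _ _ mu _ measurableT _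
  (fun x => (C%:E * ((f x)%:E + ((x - m) ^+ 2 * f x)%:E))%E)).
- exact/measurable_EFinP/measurable_funM.
- move=> x _ /=; rewrite lee_fin normrM (ger0_norm (f0 x)).
  apply: le_trans (ler_wpM2r (f0 x) (hC x)) _.
  by rewrite -mulrA mulrDl mul1r ler_norm.
- exact: (integrableZl measurableT C (integrableD measurableT imf isq)).
Qed.

(** At distance [N = n + 1] from the mean, [(1 + N) * N <= 2 * N ^ 2], and [N ^ 2 * f x] is bounded
    by [sq_pdf_le]. The resulting decay in [1 / N] kills the boundary terms in the integration by
    parts below. *)
Let bound_tail (x : R) n : (x - m) ^+ 2 = n.+1%:R ^+ 2 ->
  (1 + `|x - m|) * f x <= 8 * s ^+ 2 * normal_peak s / n.+1%:R.
Proof.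
move=> xn; have n1 : (1 : R) <= n.+1%:R by rewrite ler1n.
have xnE : `|x - m| = n.+1%:R.
  by rewrite -sqrtr_sqr xn sqrtr_sqr ger0_norm.
have p0 : 0 < normal_peak (s * Num.sqrt 2).
  by rewrite normal_peak_gt0// mulf_neq0// gt_eqF// sqrtr_gt0.
have h : (x - m) ^+ 2 * f x <= 4 * s ^+ 2 * normal_peak s.
  apply: le_trans (sq_pdf_le x) _; rewrite -mulrA ler_piMr//.
    by rewrite mulr_ge0 ?normal_peak_ge0// mulr_ge0// sqr_ge0.
  rewrite mulrC ler_pdivrMr// mul1r; apply: normal_pdf_ub.
  by rewrite mulf_neq0// gt_eqF// sqrtr_gt0.
rewrite xnE ler_pdivlMr//.
apply: (@le_trans _ _ (2 * ((x - m) ^+ 2 * f x))); last by lra.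
rewrite xn mulrAC mulrA; apply: ler_wpM2r => //.
by rewrite -[leRHS]/(2 * (n.+1%:R * n.+1%:R)); nra.
Qed.

(** Stein's identity, by integrating the derivative of [g * f], which is
    [g' * f - s ^- 2 * g * (x - m) * f]. It yields the mean ([g = 1]), the variance ([g = x - m])
    and the characteristic function ([g] a sine or cosine). *)
Lemma normal_stein (g g' : R -> R) C :
  (forall x, is_derive x (1 : R) g (g' x)) -> continuous g' ->
  (forall x, `|g x| <= C * (1 + `|x - m|)) -> (forall x, `|g' x| <= C) ->
  \int[mu]_x (g x * (x - m) * f x) = s ^+ 2 * \int[mu]_x (g' x * f x).
Proof.
move=> dg cg' gC g'C.
have C0 : 0 <= C by exact: le_trans (normr_ge0 _) (g'C 0).
have cg : continuous g.
  move=> x; apply: differentiable_continuous; apply/derivable1_diffP.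
  by have [] := dg x.
have mg : measurable_fun [set: R] g by exact: continuous_measurable_fun.
have mg' : measurable_fun [set: R] g' by exact: continuous_measurable_fun.
have ig' : mu.-integrable [set: R] (fun x => (g' x * f x)%:E).
  apply: (@integrable_normal_quadratic _ C) => // x; apply: le_trans (g'C x) _.
  by rewrite ler_peMr// lerDl sqr_ge0.
have ig : mu.-integrable [set: R] (fun x => (g x * (x - m) * f x)%:E).
  apply: (@integrable_normal_quadratic _ (2 * C)) => [|x].
    by apply: measurable_funM => //; exact: measurable_funB.
  rewrite normrM; apply: le_trans (ler_wpM2r (normr_ge0 _) (gC x)) _.
  rewrite mulrC [leRHS]mulrAC -[(x - m) ^+ 2]real_normK ?num_real//.
  by have := sqr_ge0 (`|x - m| - 1); have := normr_ge0 (x - m); nra.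
pose k x := g' x * f x - s ^- 2 * (g x * (x - m) * f x).
have dgf x : is_derive x (1 : R) (fun y => g y * f y) (k x).
  apply: is_derive_eq (is_deriveM (dg x) (is_derive_f x)) _.
  by rewrite /k /GRing.scale/=; field.
have cf : continuous f by exact: continuous_normal_pdf.
have ck : continuous k.
  move=> x; apply: cvgB; first by apply: cvgM; [exact: cg'|exact: cf].
  apply: cvgMl_tmp; apply: cvgM; last exact: cf.
  by apply: cvgM; [exact: cg|apply: cvgB; [exact: cvg_id|exact: cvg_cst]].
have ik : mu.-integrable [set: R] (EFin \o k).
  have := integrableB measurableT ig' (integrableZl measurableT (s ^- 2) ig).
  by apply: eq_integrable => // x _ /=.
have tail (x_ : nat -> R) : (forall n, (x_ n - m) ^+ 2 = n.+1%:R ^+ 2) ->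
    g (x_ n) * f (x_ n) @[n --> \oo] --> (0 : R).
  move=> xE; apply: norm_cvg0.
  apply: (@squeeze_cvgr _ _ _ _ (fun=> 0)
    (fun n => C * (8 * s ^+ 2 * normal_peak s) * n.+1%:R^-1)).
  - near=> n; rewrite normr_ge0/= normrM (ger0_norm (f0 _)).
    apply: le_trans (ler_wpM2r (f0 _) (gC _)) _.
    by have := ler_wpM2l C0 (bound_tail (xE n)); rewrite !mulrA.
  - exact: cvg_cst.
  - rewrite -[X in _ --> X](mulr0 (C * (8 * s ^+ 2 * normal_peak s))).
    by apply: cvgMl_tmp; exact: cvg_harmonic.
have : \int[mu]_x k x = 0.
  apply: (@Rintegral_derive_eq0 (fun y => g y * f y) k m) => //; apply: tail => n.
    by rewrite addrAC subrr add0r.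
  by rewrite addrAC subrr add0r sqrrN.
rewrite /k RintegralB//; last exact: (integrableZl measurableT (s ^- 2) ig).
rewrite RintegralZl// => /eqP; rewrite subr_eq0 => /eqP ->.
by rewrite mulrA divff ?mul1r// expf_neq0.
Unshelve. all: by end_near. Qed.

End normal_law.

Section linear_ode.
Context (R : realType).

Lemma linear_ode_solution (v : R) (h : R -> R) :
  (forall t, is_derive t (1 : R) h (- (v * t * h t))) ->
  forall t, h t = h 0 * expR (- (v * t ^+ 2 / 2)).
Proof.
move=> dh t.
(* The integrating factor makes [k] constant. *)
pose k u := h u * expR (v / 2 * (u * u)).
have dk u : is_derive u (1 : R) k 0.
  have h1 := is_deriveM (is_derive_id u (1 : R)) (is_derive_id u (1 : R)).
  have h2 := is_derive1_comp (is_derive_expR _) (is_deriveZ (v / 2) h1).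
  apply: (is_derive_eq (is_deriveM (dh u) h2)).
  by rewrite /GRing.scale/=; field.
have := is_derive_0_is_cst t 0 dk.
rewrite /k mulr0 mulr0 expR0 mulr1 => <-.
by rewrite -mulrA -expRD (_ : _ + _ = 0) ?expR0 ?mulr1//; field.
Qed.

End linear_ode.

Section normal_characteristic.
Context (R : realType) (m s : R).
Hypothesis s0 : s != 0.
Local Notation mu := (@lebesgue_measure R).
Let f := normal_pdf m s.

Let mB : measurable_fun [set: R] (fun x : R => x - m).
Proof. exact: measurable_funB. Qed.

Let mtB t : measurable_fun [set: R] (fun x : R => t * (x - m)).
Proof. exact: measurable_funM. Qed.

Lemma integrable_normal_bmeas (h : R -> R) : bmeas h ->
  mu.-integrable [set: R] (fun x => (h x * f x)%:E).
Proof.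
move=> [mh [M hM]]; apply: (@integrable_normal_quadratic _ _ _ s0 _ M) => // x.
apply: le_trans (hM x) _; rewrite ler_peMr//; last by rewrite lerDl sqr_ge0.
exact: le_trans (hM 0).
Qed.

Lemma integrable_normal_B_bmeas (h : R -> R) : bmeas h ->
  mu.-integrable [set: R] (fun x => ((x - m) * h x * f x)%:E).
Proof.
move=> [mh [M hM]]; apply: (@integrable_normal_quadratic _ _ _ s0 _ M) => [|x].
  exact: measurable_funM.
rewrite normrM mulrC; apply: ler_pM => //.
have := sqr_ge0 (`|x - m| - 1); rewrite -[(x - m) ^+ 2]real_normK ?num_real//.
by have := normr_ge0 (x - m); nra.
Qed.

Lemma normal_pdf_mean : \int[mu]_x ((x - m) * f x) = 0.
Proof.
have st : \int[mu]_x (1 * (x - m) * f x) = s ^+ 2 * \int[mu]_x (0 * f x).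
  apply: (@normal_stein _ _ _ s0 (fun=> 1) (fun=> 0) 1).
  - exact: cst_continuous.
  - by move=> x; rewrite normr1 mul1r lerDl.
  - by move=> x; rewrite normr0.
rewrite -[RHS](mulr0 (s ^+ 2)) (_ : 0 = \int[mu]_x (0 * f x)).
  by rewrite -st; apply: eq_Rintegral => x _; rewrite mul1r.
under eq_Rintegral do rewrite mul0r.
by rewrite Rintegral_cst// mul0r.
Qed.

Lemma normal_pdf_variance : \int[mu]_x ((x - m) ^+ 2 * f x) = s ^+ 2.
Proof.
have st : \int[mu]_x ((x - m) * (x - m) * f x) = s ^+ 2 * \int[mu]_x (1 * f x).
  apply: (@normal_stein _ _ _ s0 (fun x => x - m) (fun=> 1) 1).
  - by move=> x; apply: is_derive_eq; rewrite subr0.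
  - exact: cst_continuous.
  - by move=> x; rewrite mul1r lerDr.
  - by move=> x; rewrite normr1.
rewrite -[RHS](mulr1 (s ^+ 2)) (_ : 1 = \int[mu]_x (1 * f x)).
  by rewrite -st; apply: eq_Rintegral => x _; rewrite expr2.
under eq_Rintegral do rewrite mul1r.
by rewrite /Rintegral integral_normal_pdf.
Qed.

Let is_derive_lin t x : is_derive t (1 : R) (fun u => u * (x - m)) (x - m).
Proof.
apply: (is_derive_eq (is_deriveM (is_derive_id t 1) (is_derive_cst (x - m) t 1))).
by rewrite scaler0 add0r /GRing.scale/= mulr1.
Qed.

Let is_derive_cos_lin t x : is_derive t (1 : R) (fun u => cos (u * (x - m)))
  (- (x - m) * sin (t * (x - m))).
Proof.
apply: (is_derive_eq (is_derive1_comp (is_derive_cos _) (is_derive_lin t x))).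
by rewrite mulrC mulrN mulNr.
Qed.

Let is_derive_sin_lin t x : is_derive t (1 : R) (fun u => sin (u * (x - m)))
  ((x - m) * cos (t * (x - m))).
Proof.
apply: (is_derive_eq (is_derive1_comp (is_derive_sin _) (is_derive_lin t x))).
by rewrite mulrC.
Qed.

(** With the factor [x - m] split off and [|g'| <= 1], the function [|x - m| * f x] dominates all
    the derivatives, whatever the frequency. *)
Let derive_under (g g' : R -> R -> R) :
  (forall t, bmeas (g t)) ->
  (forall t x, is_derive t (1 : R) (g ^~ x) ((x - m) * g' t x)) ->
  (forall t x, `|g' t x| <= 1) ->
  forall t, is_derive t (1 : R) (fun t => \int[mu]_x (g t x * f x))
     (\int[mu]_x ((x - m) * g' t x * f x)).
Proof.
move=> bg dg g'1 t.
pose G x := `|x - m| * f x.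
have f0 x : 0 <= f x by exact: normal_pdf_ge0.
have intG : mu.-integrable [set: R] (EFin \o G).
  have := integrable_abse (integrable_normal_B_bmeas (bmeas_cst _ 1)).
  by apply: eq_integrable => // x _ /=; rewrite mulr1 normrM (ger0_norm (f0 x)).
have I1 : `](t - 1), (t + 1)[%classic t by rewrite /= in_itv/=; lra.
have dgf u x : is_derive u (1 : R) (fun t => g t x * f x) ((x - m) * g' u x * f x).
  apply: (is_derive_eq (is_deriveM (dg u x) (is_derive_cst (f x) u 1))).
  by rewrite scaler0 add0r /GRing.scale/= mulrC.
have p1E u x : partial1of2 (fun t x => g t x * f x) u x = (x - m) * g' u x * f x.
  by rewrite partial1of2E; have [_ ->] := dgf u x.
have ub u x : `](t - 1), (t + 1)[%classic u -> [set: R] x ->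
    `|partial1of2 (fun t x => g t x * f x) u x| <= G x.
  move=> _ _; rewrite p1E 2!normrM (ger0_norm (f0 x)) /G ler_wpM2r//.
  by rewrite ler_piMr.
have intf u : `](t - 1), (t + 1)[%classic u ->
    mu.-integrable [set: R] (EFin \o (fun x => g u x * f x)).
  by move=> _; exact: integrable_normal_bmeas.
have derf u x : `](t - 1), (t + 1)[%classic u -> [set: R] x ->
    derivable ((fun t x => g t x * f x) ^~ x) u 1.
  by move=> _ _; have [] := dgf u x.
have G0 x : 0 <= G x by rewrite mulr_ge0.
apply: DeriveDef.
  exact: (@derivable_under_integral _ _ _ mu _ _ measurableT _ _ _ I1 intf derf G G0 intG ub).
rewrite -derive1E.
rewrite (@differentiation_under_integral _ _ _ mu _ _ measurableT _ _ _ I1 intf derf G G0 intG ub).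
by apply: eq_Rintegral => x _; rewrite p1E.
Qed.

Let bcos t : bmeas (fun x : R => cos (t * (x - m))).
Proof. exact: bmeas_cos. Qed.

Let bsin t : bmeas (fun x : R => sin (t * (x - m))).
Proof. exact: bmeas_sin. Qed.

Let is_derive_lin2 t x : is_derive x (1 : R) (fun x => t * (x - m)) t.
Proof.
have h : is_derive x (1 : R) (fun x => x - m) 1.
  by apply: is_derive_eq; rewrite subr0.
apply: (is_derive_eq (is_deriveZ t h)).
by rewrite /GRing.scale/= mulr1.
Qed.

Let cont_lin t : continuous (fun x : R => t * (x - m)).
Proof.
by move=> x; apply: cvgMl_tmp; apply: cvgB; [exact: cvg_id|exact: cvg_cst].
Qed.

Let trig_bound (y x t : R) : `|y| <= 1 -> `|y| <= (1 + `|t|) * (1 + `|x - m|).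
Proof.
move=> y1; have := mulr_ge0 (normr_ge0 t) (normr_ge0 (x - m)).
by have := normr_ge0 t; have := normr_ge0 (x - m); nra.
Qed.

(** Differentiation under the integral brings out a factor [x - m], which Stein's identity trades
    for a derivative in [x]. So the transform solves [h' = - s ^ 2 * t * h], and [h 0 = 1]
    determines it. The sine transform solves the same equation with [h 0 = 0]. *)
Lemma normal_pdf_cos t :
  \int[mu]_x (cos (t * (x - m)) * f x) = expR (- (s ^+ 2 * t ^+ 2 / 2)).
Proof.
pose h u := \int[mu]_x (cos (u * (x - m)) * f x).
have dh u : is_derive u (1 : R) h (- (s ^+ 2 * u * h u)).
  move: u => {}t.
  apply: is_derive_eq.
    apply: (derive_under (g' := fun t x => - sin (t * (x - m)))) => //.
      by move=> u x; apply: (is_derive_eq (is_derive_cos_lin u x)); ring.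
    by move=> u x; rewrite normrN sin_max.
  have st : \int[mu]_x (sin (t * (x - m)) * (x - m) * f x) =
      s ^+ 2 * \int[mu]_x (t * cos (t * (x - m)) * f x).
    apply: (@normal_stein _ _ _ s0 _ _ (1 + `|t|)).
    - move=> x; apply: (is_derive_eq (is_derive1_comp (is_derive_sin _) (is_derive_lin2 t x))).
      by rewrite mulrC.
    - move=> x; apply: cvgMl_tmp.
      apply: (@continuous_comp _ _ _ (fun x : R => t * (x - m)) (@cos R)).
        exact: cont_lin.
      exact: continuous_cos.
    - by move=> x; apply: trig_bound; exact: sin_max.
    - move=> x; rewrite normrM; have := cos_max (t * (x - m)); have := normr_ge0 t.
      by nra.
  transitivity (\int[mu]_x (-1 * (sin (t * (x - m)) * (x - m) * f x))).
    by apply: eq_Rintegral => x _; ring.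
  rewrite RintegralZl//; last first.
    have := integrable_normal_B_bmeas (bsin t).
    by apply: eq_integrable => // x _ /=; congr EFin; ring.
  rewrite {}st mulN1r; congr (- _); rewrite -mulrA; congr (_ * _).
  rewrite -RintegralZl//; last exact: integrable_normal_bmeas.
  by apply: eq_Rintegral => x _; rewrite mulrA.
rewrite -[LHS]/(h t) (linear_ode_solution dh).
rewrite (_ : h 0 = 1) ?mul1r// /h.
under eq_Rintegral do rewrite mul0r cos0 mul1r.
by rewrite /Rintegral integral_normal_pdf.
Qed.

Lemma normal_pdf_sin t : \int[mu]_x (sin (t * (x - m)) * f x) = 0.
Proof.
pose h u := \int[mu]_x (sin (u * (x - m)) * f x).
have dh u : is_derive u (1 : R) h (- (s ^+ 2 * u * h u)).
  move: u => {}t.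
  apply: is_derive_eq.
    apply: (derive_under (g' := fun t x => cos (t * (x - m)))) => //.
    by move=> u x; rewrite cos_max.
  have st : \int[mu]_x (cos (t * (x - m)) * (x - m) * f x) =
      s ^+ 2 * \int[mu]_x (- t * sin (t * (x - m)) * f x).
    apply: (@normal_stein _ _ _ s0 _ _ (1 + `|t|)).
    - move=> x; apply: (is_derive_eq (is_derive1_comp (is_derive_cos _) (is_derive_lin2 t x))).
      by ring.
    - move=> x; apply: cvgMl_tmp.
      apply: (@continuous_comp _ _ _ (fun x : R => t * (x - m)) (@sin R)).
        exact: cont_lin.
      exact: continuous_sin.
    - by move=> x; apply: trig_bound; exact: cos_max.
    - move=> x; rewrite normrM normrN; have := sin_max (t * (x - m)); have := normr_ge0 t.
      by nra.
  transitivity (\int[mu]_x (cos (t * (x - m)) * (x - m) * f x)).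
    by apply: eq_Rintegral => x _; ring.
  rewrite {}st -mulrA -mulrN; congr (_ * _); rewrite -mulNr.
  rewrite -RintegralZl//; last exact: integrable_normal_bmeas.
  by apply: eq_Rintegral => x _; rewrite mulrA.
rewrite -[LHS]/(h t) (linear_ode_solution dh).
rewrite (_ : h 0 = 0) ?mul0r// /h.
under eq_Rintegral do rewrite mul0r sin0 mul0r.
by rewrite Rintegral_cst// mul0r.
Qed.

End normal_characteristic.

Section gaussian_random_variable.
Context d (T : measurableType d) (R : realType) (P : probability T R).
Variable Y : T -> R.
Hypothesis mY : measurable_fun [set: T] Y.

Section transfer.
Variable nu : {measure set (measurableTypeR R) -> \bar R}.
Hypothesis nuY : forall A : set R, measurable A -> pushforward P Y A = nu A.

Let mY' : measurable_fun [set: T] (Y : T -> measurableTypeR R).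
Proof. exact: mY. Qed.

Lemma integrable_law (h : R -> R) : measurable_fun [set: R] h ->
  nu.-integrable [set: R] (fun x => (h x)%:E) ->
  P.-integrable [set: T] (fun w => (h (Y w))%:E).
Proof.
move=> mh /integrableP[_ ih]; apply/integrableP; split.
  by apply/measurable_EFinP; exact: measurableT_comp.
have mh' : measurable_fun [set: measurableTypeR R] (fun x => `|(h x)%:E|%E).
  by apply: measurableT_comp => //; exact/measurable_EFinP.
have := @ge0_integral_pushforward _ _ _ _ _ _ mY' P _ _ measurableT mh'.
rewrite preimage_setT => <-//.
move: ih; congr (_ < _)%E; apply/esym.
by apply: eq_measure_integral => A mA _; exact: nuY.
Qed.

Lemma integral_law (h : R -> R) : measurable_fun [set: R] h ->
  nu.-integrable [set: R] (fun x => (h x)%:E) ->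
  (\int[P]_w (h (Y w))%:E = \int[nu]_x (h x)%:E)%E.
Proof.
move=> mh ih.
have mh' : measurable_fun [set: measurableTypeR R] (fun x => (h x)%:E) by exact/measurable_EFinP.
have := @integral_pushforward _ _ _ _ _ _ mY' P setT _ mh'.
rewrite preimage_setT => /(_ (integrable_law mh ih) measurableT) <-.
by apply: eq_measure_integral => A mA _; exact: nuY.
Qed.

End transfer.

(** The facts about Gaussian laws used later, in a form common to normal laws and point masses
    ([v = 0]). Positivity of both half-line probabilities is the one fact that needs [v != 0]. *)
Definition gaussian_with (m v : R) :=
  [/\ P.-integrable [set: T] (fun w => (Y w - m)%:E),
      P.-integrable [set: T] (fun w => ((Y w - m) ^+ 2)%:E),
      \int[P]_w (Y w - m) = 0 & \int[P]_w ((Y w - m) ^+ 2) = v] /\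
  [/\ forall t, \int[P]_w cos (t * (Y w - m)) = expR (- (v * t ^+ 2 / 2)),
      forall t, \int[P]_w sin (t * (Y w - m)) = 0 &
      v != 0 -> forall a, (0 < P [set w | (a <= Y w)%R])%E /\
                          (0 < P [set w | (Y w < a)%R])%E].

Let mB (m : R) : measurable_fun [set: R] (fun x : R => x - m).
Proof. exact: measurable_funB. Qed.

Let mtB (m t : R) : measurable_fun [set: R] (fun x : R => t * (x - m)).
Proof. exact: measurable_funM. Qed.

Lemma normal_prob_gt0 (m s b : R) (A : set R) : s != 0 -> measurable A ->
  `[b, b + 1]%classic `<=` A -> (0 < normal_prob m s A)%E.
Proof.
move=> s0 mA bA.
(* A lower bound of the density on [[b, b + 1]], where [|x - m| <= |b - m| + 1]; the interval has
   length 1, so [c] also bounds its probability. *)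
pose c := normal_peak s * expR (- (`|b - m| + 1) ^+ 2 / (s ^+ 2 *+ 2)).
have c0 : 0 < c by rewrite mulr_gt0 ?expR_gt0 ?normal_peak_gt0.
apply: (@lt_le_trans _ _ c%:E); first by rewrite lte_fin.
apply: (@le_trans _ _ (normal_prob m s `[b, b + 1]%classic)); last first.
  by apply: (le_measure (normal_prob m s)); rewrite ?inE.
rewrite /normal_prob.
have -> : c%:E = (\int[lebesgue_measure]_(x in `[b, (b + 1)%R]%classic) c%:E)%E.
  rewrite integral_cst//= lebesgue_measure_itv/= lte_fin ltrDl ltr01 -EFinD.
  by rewrite addrAC subrr add0r mule1.
apply: ge0_le_integral => //.
- by move=> x _; rewrite lee_fin ltW.
- by apply/measurable_EFinP/measurable_funTS; exact: measurable_normal_pdf.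
move=> x; rewrite /= in_itv/= => /andP[bx xb]; rewrite lee_fin normal_pdfE//.
rewrite ler_wpM2l ?normal_peak_ge0// ler_expR !mulNr lerN2.
apply: ler_wpM2r; first by rewrite invr_ge0 mulrn_wge0// sqr_ge0.
rewrite -(@real_normK _ (x - m)) ?num_real// ler_sqr ?nnegrE ?addr_ge0//.
rewrite (_ : x - m = (b - m) + (x - b)); last by ring.
by rewrite (le_trans (ler_normD _ _))// lerD2l ger0_norm; lra.
Qed.

Lemma gaussian_rvP : gaussian_rv P Y -> exists m v, gaussian_with m v.
Proof.
move=> [_ [m [s nuY]]]; exists m.
have [s0|s0] := eqVneq s 0.
  pose Dm : {measure set (measurableTypeR R) -> \bar R} :=
    dirac (m : measurableTypeR R).
  have nuY' A : measurable A -> pushforward P Y A = Dm A.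
    by move=> mA; rewrite nuY// s0 eqxx.
  have idirac h : measurable_fun [set: R] h ->
      Dm.-integrable [set: R] (fun x => (h x)%:E).
    move=> mh.
    have mh' : measurable_fun [set: measurableTypeR R] (EFin \o h).
      exact/measurable_EFinP.
    apply/integrableP; split => //.
    have mah : measurable_fun [set: measurableTypeR R] (fun x => `|(h x)%:E|%E).
      exact: measurableT_comp mh'.
    by rewrite (integral_dirac _ measurableT mah) diracT mul1e ltry.
  have Edirac h : measurable_fun [set: R] h -> \int[P]_w (h (Y w)) = h m.
    move=> mh; rewrite /Rintegral (integral_law nuY' mh (idirac _ mh)).
    have mh' : measurable_fun [set: measurableTypeR R] (EFin \o h).
      exact/measurable_EFinP.
    by rewrite (integral_dirac _ measurableT mh') diracT mul1e.
  have mX : measurable_fun [set: R] (fun x : R => (x - m) ^+ 2).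
    exact: measurable_funX.
  have mc t : measurable_fun [set: R] (fun x => cos (t * (x - m))).
    by have [] := bmeas_cos (mtB m t).
  have ms t : measurable_fun [set: R] (fun x => sin (t * (x - m))).
    by have [] := bmeas_sin (mtB m t).
  exists 0; split; split.
  - exact: (integrable_law nuY' (mB m) (idirac _ (mB m))).
  - exact: (integrable_law nuY' mX (idirac _ mX)).
  - by rewrite (Edirac _ (mB m)) subrr.
  - by rewrite (Edirac _ mX) subrr expr0n.
  - by move=> t; rewrite (Edirac _ (mc t)) subrr mulr0 cos0 !mul0r oppr0 expR0.
  - by move=> t; rewrite (Edirac _ (ms t)) subrr mulr0 sin0.
  - by rewrite eqxx.
have nuY' A : measurable A ->
    pushforward P Y A = (normal_prob m s : {measure set (measurableTypeR R) -> \bar R}) A.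
  by move=> mA; rewrite nuY// (negbTE s0).
exists (s ^+ 2).
have I (h : R -> R) : measurable_fun [set: R] h ->
    lebesgue_measure.-integrable [set: R] (fun x => (h x * normal_pdf m s x)%:E) ->
    P.-integrable [set: T] (fun w => (h (Y w))%:E) /\
    \int[P]_w (h (Y w)) = \int[lebesgue_measure]_x (h x * normal_pdf m s x).
  move=> mh ih; have ih' := integrable_normal_prob mh ih.
  split; first exact: (integrable_law nuY' mh ih').
  by rewrite /Rintegral (integral_law nuY' mh ih') (integral_normal_prob mh ih).
have bc t := bmeas_cos (mtB m t); have bs t := bmeas_sin (mtB m t).
have [iB EB] : P.-integrable [set: T] (fun w => (Y w - m)%:E) /\
    \int[P]_w (Y w - m) = \int[lebesgue_measure]_x ((x - m) * normal_pdf m s x).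
  apply: (I (fun x => x - m)) => //.
  have := integrable_normal_B_bmeas m s0 (bmeas_cst _ 1).
  by apply: eq_integrable => // x _; rewrite mulr1.
have [iX EX] : P.-integrable [set: T] (fun w => ((Y w - m) ^+ 2)%:E) /\
    \int[P]_w ((Y w - m) ^+ 2) = \int[lebesgue_measure]_x ((x - m) ^+ 2 * normal_pdf m s x).
  apply: (I (fun x => (x - m) ^+ 2)); first exact: measurable_funX.
  apply: (@integrable_normal_quadratic _ _ _ s0 _ 1); first exact: measurable_funX.
  by move=> x; rewrite ger0_norm ?sqr_ge0// mul1r lerDr.
split; split => //.
- by rewrite EB normal_pdf_mean.
- by rewrite EX normal_pdf_variance.
- move=> t; have [_ ->] := I _ (bc t).1 (integrable_normal_bmeas m s0 (bc t)).
  exact: normal_pdf_cos.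
- move=> t; have [_ ->] := I _ (bs t).1 (integrable_normal_bmeas m s0 (bs t)).
  exact: normal_pdf_sin.
- move=> _ a; split.
    have -> : [set w | a <= Y w] = Y @^-1` `[a, +oo[%classic.
      by apply/seteqP; split=> x /=; rewrite in_itv/= andbT.
    rewrite -[P _]/(pushforward P Y _) nuY'//=.
    apply: (@normal_prob_gt0 _ _ a) => //.
    by move=> x; rewrite /= !in_itv/= andbT => /andP[].
  have -> : [set w | Y w < a] = Y @^-1` `]-oo, a[%classic.
    by apply/seteqP; split=> x /=; rewrite in_itv.
  rewrite -[P _]/(pushforward P Y _) nuY'//=.
  (* The closed interval [[a - 2, a - 1]] avoids the excluded endpoint [a]. *)
  apply: (@normal_prob_gt0 _ _ (a - 2)) => //.
  by move=> x; rewrite /= !in_itv/= => /andP[]; lra.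
Qed.

End gaussian_random_variable.

(** * Projections on tail spans *)

Section semi_inner_product.
Context (R : realType) (ip : {poly R} -> {poly R} -> R).
Hypothesis ipC : forall u v, ip u v = ip v u.
Hypothesis ipDl : forall u v w, ip (u + v) w = ip u w + ip v w.
Hypothesis ipZl : forall c u v, ip (c *: u) v = c * ip u v.
Hypothesis ip_ge0 : forall u, 0 <= ip u u.
Implicit Types u v w p q : {poly R}.

Let ipDr u v w : ip u (v + w) = ip u v + ip u w.
Proof. by rewrite !(ipC u) ipDl. Qed.

Let ipZr c u v : ip u (c *: v) = c * ip u v.
Proof. by rewrite !(ipC u) ipZl. Qed.

Let ip0l u : ip 0 u = 0.
Proof. by rewrite -(scale0r 0) ipZl mul0r. Qed.

Let ip0r u : ip u 0 = 0.
Proof. by rewrite ipC ip0l. Qed.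

Let ipNl u v : ip (- u) v = - ip u v.
Proof. by rewrite -scaleN1r ipZl mulN1r. Qed.

Let ipNr u v : ip u (- v) = - ip u v.
Proof. by rewrite ipC ipNl ipC. Qed.

Lemma semi_cauchy_schwarz u v : ip u v ^+ 2 <= ip u u * ip v v.
Proof.
have := ip_ge0 v; rewrite le_eqVlt => /predU1P[/esym v0|v0]; last first.
  (* The square norm of this vector is [ip v v * (ip u u * ip v v - ip u v ^+ 2)]. *)
  have := ip_ge0 (ip v v *: u - ip u v *: v).
  rewrite !(ipDl, ipDr, ipNl, ipNr, ipZl, ipZr) (ipC v u) => h.
  rewrite -(ler_pM2r v0) -subr_ge0; move: h; congr (0 <= _); ring.
rewrite v0 mulr0; have [->|uv0] := eqVneq (ip u v) 0; first by rewrite expr0n.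
(* A null vector [v] need not be 0. If [ip u v] were nonzero, this multiple of [v] would bring the
   square norm of the difference down to -1. *)
have := ip_ge0 (u - ((ip u u + 1) / (2 * ip u v)) *: v).
rewrite !(ipDl, ipDr, ipNl, ipNr, ipZl, ipZr) (ipC v u) v0.
set t := (_ / _); have -> : t * ip u v = (ip u u + 1) / 2 by rewrite /t; field.
by move=> h; exfalso; lra.
Qed.

(** Gram-Schmidt, one index at a time. As the form is only semidefinite, the new direction [z] may
    be null; then the Cauchy-Schwarz inequality makes the residual orthogonal to it anyway. *)
Lemma exists_projection n N u :
  exists2 h, supported n N h & forall v, supported n N v -> ip (u - h) v = 0.
Proof.
have [nN|Nn] := leqP n N; last first.
  exists 0 => [i _|v hv]; first by rewrite coef0.
  rewrite (_ : v = 0) ?ip0r//; apply/polyP => i; rewrite coef0; apply: hv; lia.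
rewrite -(subnKC nN); move: (N - n)%N => k {N nN}.
elim: k u => [|k ih] u.
  exists 0 => [i _|v hv]; first by rewrite coef0.
  rewrite (_ : v = 0) ?ip0r//; apply/polyP => i; rewrite coef0; apply: hv; lia.
have [hu su ou] := ih u; have [hz sz oz] := ih 'X^(n + k).
set z := 'X^(n + k) - hz.
pose a := ip (u - hu) z / ip z z.
have sub i : ~~ (n <= i < n + k.+1)%N -> ~~ (n <= i < n + k)%N by lia.
exists (hu + a *: z) => [i hi|v hv].
  rewrite coefD coefZ coefB coefXn su ?sz//; last 2 first.
  - exact: sub.
  - exact: sub.
  by rewrite (_ : i == (n + k)%N = false) ?subr0 ?mulr0 ?addr0//; lia.
pose c := v`_(n + k).
(* Subtracting [c *: z] from [v], with [c] its top coefficient, leaves a vector of the old window,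
   to which both [u - hu] and [z] are orthogonal. *)
have hw : supported n (n + k) (c *: hz + (v - c *: 'X^(n + k))).
  move=> i hi; rewrite coefD coefZ coefB coefZ coefXn sz// mulr0 add0r.
  have [->|ink] := eqVneq i (n + k)%N; first by rewrite mulr1 subrr.
  by rewrite mulr0 subr0 hv//; lia.
have vE : v = c *: z + (c *: hz + (v - c *: 'X^(n + k))).
  by rewrite /z scalerBr addrA subrK addrC subrK.
rewrite vE ipDr ipZr.
have -> : ip (u - (hu + a *: z)) (c *: hz + (v - c *: 'X^(n + k))) = 0.
  by rewrite opprD addrA ipDl ou// ipNl ipZl oz// mulr0 oppr0 addr0.
rewrite addr0 opprD addrA ipDl ipNl ipZl /a.
have [z0|z0] := eqVneq (ip z z) 0; last by rewrite divfK// subrr mulr0.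
have := semi_cauchy_schwarz (u - hu) z; rewrite z0 !mulr0.
rewrite le_eqVlt ltNge sqr_ge0 orbF sqrf_eq0 => /eqP ->.
by rewrite subr0 mulr0.
Qed.

Hypothesis ip_le0 : forall i j, i != j -> ip 'X^i 'X^j <= 0.

(** In the bilinear expansion the diagonal terms vanish by disjointness, so no square [ip 'X^i 'X^i]
    contributes. *)
Lemma ip_disjoint_le0 p q : (forall i, 0 <= p`_i) -> (forall i, 0 <= q`_i) ->
  (forall i, p`_i * q`_i = 0) -> ip p q <= 0.
Proof.
move=> p0 q0 pq0.
have sumE (n : nat) (F : nat -> {poly R}) u :
    ip (\sum_(i < n) F i) u = \sum_(i < n) ip (F i) u.
  elim: n => [|n ih]; first by rewrite !big_ord0 ip0l.
  by rewrite !big_ord_recr/= ipDl ih.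
rewrite -[p]coefK -[q]coefK !poly_def (sumE _ (fun i => p`_i *: 'X^i)).
apply: sumr_le0 => i _; rewrite ipC (sumE _ (fun i => q`_i *: 'X^i)).
apply: sumr_le0 => j _; rewrite ipZl ipZr mulrA.
have [->|ij] := eqVneq (j : nat) i; first by rewrite (mulrC q`_i) pq0 mul0r.
by rewrite mulr_ge0_le0 ?mulr_ge0// ip_le0.
Qed.

Let ppos p := \poly_(i < size p) Num.max p`_i 0.
Let pneg p := \poly_(i < size p) Num.max (- p`_i) 0.

Let coef_ppos p i : (ppos p)`_i = Num.max p`_i 0.
Proof.
by rewrite coef_poly; case: ltnP => // pi; rewrite nth_default// maxxx.
Qed.

Let coef_pneg p i : (pneg p)`_i = Num.max (- p`_i) 0.
Proof.
by rewrite coef_poly; case: ltnP => // pi; rewrite nth_default// oppr0 maxxx.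
Qed.

Let pposB p : p = ppos p - pneg p.
Proof.
apply/polyP => i; rewrite coefB coef_ppos coef_pneg.
by case: (lerP 0 p`_i); case: (lerP 0 (- p`_i)); lra.
Qed.

(** Each layer adds at most [ip u u] to either square norm, since its cross terms with the stack are
    nonpositive. This needs nonnegative coefficients, so [p] and [q] are kept apart instead of
    forming [p - q]. *)
Let tails_stack u e (K : nat) :
  (forall n, exists N h, [/\ supported n N h, ip u h = ip h h & e <= ip h h]) ->
  forall n, exists N p q,
    [/\ supported n N p, supported n N q,
        forall i, 0 <= p`_i /\ 0 <= q`_i,
        ip p p <= K%:R * ip u u /\ ip q q <= K%:R * ip u u &
        K%:R * e <= ip u p - ip u q].
Proof.
move=> H; elim: K => [|K ih] n.
  exists n, 0, 0; split; try by move=> i; rewrite coef0.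
  - by rewrite ip0l mul0r.
  - by rewrite ip0r mul0r subrr.
have [N1 [h [sh uh eh]]] := H n.
(* Starting the rest of the stack at [maxn n N1] keeps it beyond [n] and disjoint from [h]. *)
have [N2 [p [q [sp sq pq0 [pK qK] eK]]]] := ih (maxn n N1).
have [S0 h0] := (ip_ge0 u, ip_ge0 h).
have hS : ip h h <= ip u u.
  have := semi_cauchy_schwarz u h; rewrite uh expr2.
  have [->//|hn0] := eqVneq (ip h h) 0.
  by rewrite ler_pM2r// lt_neqAle eq_sym hn0.
have pos0 i : 0 <= (ppos h)`_i by rewrite coef_ppos le_max lexx orbT.
have neg0 i : 0 <= (pneg h)`_i by rewrite coef_pneg le_max lexx orbT.
have hE : ip h h = ip (ppos h) (ppos h) + ip (pneg h) (pneg h) - 2 * ip (ppos h) (pneg h).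
  by rewrite {1 2}(pposB h) !(ipDl, ipDr, ipNl, ipNr) (ipC (pneg h) (ppos h)); ring.
(* Hence the square norms of the two parts add up to at most [ip h h], which is at most [ip u u] by
   [hS]. *)
have cross : ip (ppos h) (pneg h) <= 0.
  apply: ip_disjoint_le0 => // i; rewrite coef_ppos coef_pneg.
  by case: (lerP 0 h`_i); case: (lerP 0 (- h`_i)); rewrite ?mul0r ?mulr0//; nra.
have [pp nn] := (ip_ge0 (ppos h), ip_ge0 (pneg h)).
have spos : supported n N1 (ppos h) by move=> i hi; rewrite coef_ppos sh// maxxx.
have sneg : supported n N1 (pneg h) by move=> i hi; rewrite coef_pneg sh// oppr0 maxxx.
have disj (x y : {poly R}) : supported n N1 x -> supported (maxn n N1) N2 y ->
    forall i, x`_i * y`_i = 0.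
  move=> sx sy i; have [iN|Ni] := ltnP i N1.
    by rewrite sy ?mulr0//; clear -iN; lia.
  by rewrite sx ?mul0r//; clear -Ni; lia.
have c1 : ip (ppos h) p <= 0.
  by apply: ip_disjoint_le0 => // [i|]; [have [] := pq0 i|exact: disj].
have c2 : ip (pneg h) q <= 0.
  by apply: ip_disjoint_le0 => // [i|]; [have [] := pq0 i|exact: disj].
exists (maxn N1 N2), (ppos h + p), (pneg h + q); split.
- by move=> i hi; rewrite coefD spos ?sp ?addr0//; clear -hi; lia.
- by move=> i hi; rewrite coefD sneg ?sq ?addr0//; clear -hi; lia.
- by move=> i; have [? ?] := pq0 i; rewrite !coefD !addr_ge0.
- rewrite !(ipDl, ipDr) (ipC p) (ipC q) -natr1 !mulrDl !mul1r; split; lra.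
- have : ip u h = ip u (ppos h) - ip u (pneg h) by rewrite {1}(pposB h) ipDr ipNr.
  by rewrite !ipDr -natr1 mulrDl mul1r; lra.
Qed.

(* Nonpositive correlations force the projections on the tail spans to
   vanish: stacking [K] disjointly supported projections, the positive and the
   negative parts have square norm at most [K |u|^2], whereas their difference
   has inner product at least [K e] with [u]. *)
Lemma tail_projection_small u e : 0 < e -> exists n, forall N h,
  supported n N h -> (forall v, supported n N v -> ip (u - h) v = 0) -> ip h h < e.
Proof.
move=> e0; apply: contrapT => H.
have {}H n : exists N h, [/\ supported n N h, ip u h = ip h h & e <= ip h h].
  apply: contrapT => Hn; apply: H; exists n => N h sh oh.
  rewrite ltNge; apply/negP => eh; apply: Hn; exists N, h; split=> //.
  by apply/eqP; rewrite -subr_eq0 -ipNl -ipDl oh.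
(* [K] is chosen with [4 * S ^ 2 < K * e ^ 2]: stacking gives
   [(K * e) ^ 2 <= (ip u p - ip u q) ^ 2], and Cauchy-Schwarz bounds the right side by
   [4 * K * S ^ 2]. *)
pose S := ip u u; pose K := (Num.truncn (4 * S ^+ 2 / e ^+ 2)).+1.
have KS : 4 * S ^+ 2 < K%:R * e ^+ 2.
  by rewrite -ltr_pdivrMr ?exprn_gt0// /K truncnS_gt.
have [N [p [q [_ _ _ [pK qK] eK]]]] := tails_stack K H 0%N.
have S0 : 0 <= S := ip_ge0 u.
have csp : ip u p ^+ 2 <= K%:R * S ^+ 2.
  apply: le_trans (semi_cauchy_schwarz u p) _; rewrite -/S expr2 mulrCA.
  by rewrite ler_wpM2l.
have csq : ip u q ^+ 2 <= K%:R * S ^+ 2.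
  apply: le_trans (semi_cauchy_schwarz u q) _; rewrite -/S expr2 mulrCA.
  by rewrite ler_wpM2l.
have K0 : 0 < K%:R :> R by rewrite /K.
have Ke : 0 <= K%:R * e by rewrite mulr_ge0// ltW.
have : (K%:R * e) ^+ 2 <= (ip u p - ip u q) ^+ 2.
  by rewrite ler_sqr ?nnegrE// (le_trans Ke).
have := sqr_ge0 (ip u p + ip u q).
have : K%:R * (4 * S ^+ 2) < (K%:R * e) ^+ 2.
  by rewrite exprMn expr2 -mulrA ltr_pM2l.
nra.
Qed.

End semi_inner_product.

(** * Covariances of a Gaussian process *)

Section trig_orth_operations.
Context d (T : measurableType d) (R : realType) (P : probability T R).
Implicit Types psi Y : T -> R.

Lemma trig_orth_linear psi psi' Y (a b : R) :
  bmeas psi -> bmeas psi' -> measurable_fun [set: T] Y ->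
  trig_orth P psi Y -> trig_orth P psi' Y ->
  trig_orth P (fun w => a * psi w + b * psi' w) Y.
Proof.
move=> bp bp' mY [c1 s1] [c2 s2].
have bc := bmeas_cos mY; have bs := bmeas_sin mY.
have key (f : T -> R) : bmeas f -> \int[P]_w (psi w * f w) = 0 ->
    \int[P]_w (psi' w * f w) = 0 ->
    \int[P]_w ((a * psi w + b * psi' w) * f w) = 0.
  move=> bf f0 f0'.
  under eq_Rintegral do rewrite mulrDl -!mulrA.
  rewrite Rintegral_bmeasD; last 2 first.
  - by apply: bmeasM (bmeas_cst _ _) _; exact: bmeasM.
  - by apply: bmeasM (bmeas_cst _ _) _; exact: bmeasM.
  by rewrite !Rintegral_bmeasZ ?f0 ?f0' ?mulr0 ?addr0//; exact: bmeasM.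
by split; exact: key.
Qed.

Lemma trig_orth_shift psi Y (c : R) : bmeas psi -> measurable_fun [set: T] Y ->
  trig_orth P psi Y -> trig_orth P psi (fun w => Y w + c).
Proof.
move=> bp mY [c1 s1].
have bc : bmeas (fun w => psi w * cos (Y w)) by apply: bmeasM => //; exact: bmeas_cos.
have bs : bmeas (fun w => psi w * sin (Y w)) by apply: bmeasM => //; exact: bmeas_sin.
have key (f : T -> R) (a b : R) :
    (forall w, f w = a * (psi w * cos (Y w)) + b * (psi w * sin (Y w))) ->
    \int[P]_w f w = 0.
  move=> fE; under eq_Rintegral do rewrite fE.
  rewrite Rintegral_bmeasD; last 2 first.
  - exact: bmeasM (bmeas_cst _ _) _.
  - exact: bmeasM (bmeas_cst _ _) _.
  by rewrite !Rintegral_bmeasZ// c1 s1 !mulr0 addr0.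
split.
- by apply: (key _ (cos c) (- sin c)) => w; rewrite cosD; ring.
- by apply: (key _ (sin c) (cos c)) => w; rewrite sinD; ring.
Qed.

End trig_orth_operations.

Section square_integrable.
Context d (T : measurableType d) (R : realType) (P : probability T R).

Lemma integrable_mul_sq (f g : T -> R) :
  measurable_fun [set: T] f -> measurable_fun [set: T] g ->
  P.-integrable [set: T] (fun w => (f w ^+ 2)%:E) ->
  P.-integrable [set: T] (fun w => (g w ^+ 2)%:E) ->
  P.-integrable [set: T] (fun w => (f w * g w)%:E).
Proof.
move=> mf mg if2 ig2; apply: (le_integrable _ _ _ (integrableD measurableT if2 ig2)) => //.
- by apply/measurable_EFinP; exact: measurable_funM.
- move=> w _ /=; rewrite lee_fin [leRHS]ger0_norm ?addr_ge0 ?sqr_ge0// ler_norml.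
  by have := sqr_ge0 (f w + g w); have := sqr_ge0 (f w - g w); nra.
Qed.

End square_integrable.

Section gaussian_process_covariance.
Context d (T : measurableType d) (R : realType) (P : probability T R).
Variable Z : nat -> {RV P >-> R}.
Hypothesis gZ : gaussian_process Z.
Implicit Types p q : {poly R}.

Local Notation L := (lin (fun i => Z i : T -> R)).

Let mZ i : measurable_fun [set: T] (Z i : T -> R).
Proof. exact: measurable_funP. Qed.

Let mL p : measurable_fun [set: T] (L p).
Proof. exact: measurable_lin. Qed.

Definition centered p (w : T) : R := L p w - \int[P]_x L p x.

Definition cov p q : R := \int[P]_w (centered p w * centered q w).

Local Notation cen := centered.

Lemma measurable_centered p : measurable_fun [set: T] (cen p).
Proof. exact: measurable_funB. Qed.

Let gaussian_lin p : exists m v, gaussian_with P (L p) m v.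
Proof.
apply: gaussian_rvP => //.
have := @gZ (size p) (fun k : 'I_(size p) => k : nat) (@ord_inj _) (fun k => p`_k).
exact.
Qed.

Let integrable_lin p : P.-integrable [set: T] (fun w => (L p w)%:E).
Proof.
have [m [v [[iB _ _ _] _]]] := gaussian_lin p.
have := integrableD measurableT iB (bmeas_integrable P (bmeas_cst _ m)).
by apply: eq_integrable => // w _; rewrite /= -EFinD subrK.
Qed.

Lemma gaussian_centered p : gaussian_with P (L p) (\int[P]_x L p x) (cov p p).
Proof.
have [m [v g]] := gaussian_lin p.
have [[iB iX EB EX] _] := g.
have mE : \int[P]_x L p x = m.
  apply/eqP; rewrite -subr_eq0 -(Rintegral_prob_cst P m).
  by rewrite -(RintegralB measurableT (integrable_lin p) (bmeas_integrable P (bmeas_cst _ m))) EB.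
have vE : cov p p = v.
  by rewrite /cov /centered mE -EX; apply: eq_Rintegral => w _; rewrite expr2.
by rewrite mE vE.
Qed.

Lemma integrable_centered_sq p : P.-integrable [set: T] (fun w => (cen p w ^+ 2)%:E).
Proof. by have [[]] := gaussian_centered p. Qed.

Let integrable_cenM p q : P.-integrable [set: T] (fun w => (cen p w * cen q w)%:E).
Proof.
apply: integrable_mul_sq; [exact: measurable_centered..|exact: integrable_centered_sq|exact: integrable_centered_sq].
Qed.

Lemma centeredD p q w : cen (p + q) w = cen p w + cen q w.
Proof.
rewrite /centered linD; under eq_Rintegral do rewrite linD.
rewrite RintegralD//; [|exact: integrable_lin..].
by rewrite opprD addrACA.
Qed.

Lemma centeredZ c p w : cen (c *: p) w = c * cen p w.
Proof.
rewrite /centered linZ; under eq_Rintegral do rewrite linZ.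
rewrite RintegralZl//; last exact: integrable_lin.
by rewrite mulrBr.
Qed.

Lemma centeredB p q w : cen (p - q) w = cen p w - cen q w.
Proof. by rewrite centeredD -scaleN1r centeredZ mulN1r. Qed.

Lemma covC p q : cov p q = cov q p.
Proof. by apply: eq_Rintegral => w _; rewrite mulrC. Qed.

Lemma covDl p q r : cov (p + q) r = cov p r + cov q r.
Proof.
rewrite /cov -RintegralD//; [|exact: integrable_cenM..].
by apply: eq_Rintegral => w _; rewrite centeredD mulrDl.
Qed.

Lemma covZl c p q : cov (c *: p) q = c * cov p q.
Proof.
rewrite /cov -RintegralZl//; last exact: integrable_cenM.
by apply: eq_Rintegral => w _; rewrite centeredZ mulrA.
Qed.

Lemma cov_ge0 p : 0 <= cov p p.
Proof. by apply: Rintegral_ge0 => w _; rewrite -expr2 sqr_ge0. Qed.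

Let covNl p q : cov (- p) q = - cov p q.
Proof. by rewrite -scaleN1r covZl mulN1r. Qed.

Let cov_sq (p q : {poly R}) : cov p q = 0 ->
  cov (p + q) (p + q) = cov p p + cov q q /\ cov (p - q) (p - q) = cov p p + cov q q.
Proof.
move=> pq0; have qp0 : cov q p = 0 by rewrite covC.
rewrite !covDl !covNl !(covC _ (p + q)) !(covC _ (p - q)) !covDl !covNl pq0 qp0.
by split; ring.
Qed.

Lemma Rintegral_cos_centered p : \int[P]_w cos (cen p w) = expR (- (cov p p / 2)).
Proof.
have [_ [h _ _]] := gaussian_centered p; have := h 1.
by under eq_Rintegral do rewrite mul1r; rewrite expr1n mulr1.
Qed.

Lemma Rintegral_sin_centered p : \int[P]_w sin (cen p w) = 0.
Proof.
have [_ [_ h _]] := gaussian_centered p; have := h 1.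
by under eq_Rintegral do rewrite mul1r.
Qed.

Let bcos p : bmeas (fun w => cos (cen p w)).
Proof. by apply: bmeas_cos; exact: measurable_centered. Qed.

Let bsin p : bmeas (fun w => sin (cen p w)).
Proof. by apply: bmeas_sin; exact: measurable_centered. Qed.

Let lin2 (f g h : T -> R) (a b : R) : bmeas g -> bmeas h ->
  (forall w, f w = a * g w + b * h w) ->
  \int[P]_w f w = a * \int[P]_w g w + b * \int[P]_w h w.
Proof.
move=> bg bh fE; under eq_Rintegral do rewrite fE.
rewrite Rintegral_bmeasD ?Rintegral_bmeasZ//.
- exact: bmeasM (bmeas_cst _ _) _.
- exact: bmeasM (bmeas_cst _ _) _.
Qed.

(** Both [p + q] and [p - q] have variance [cov p p + cov q q], so their characteristic functions
    agree and factorize. Only the cosine needs centering; the sine has mean 0 by symmetry. *)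
Lemma uncorrelated_trig_orth p q : cov p q = 0 ->
  trig_orth P (fun w => cos (cen p w) - expR (- (cov p p / 2))) (cen q) /\
  trig_orth P (fun w => sin (cen p w)) (cen q).
Proof.
move=> pq0; have [eD eB] := cov_sq pq0; split; split.
- pose k := expR (- (cov p p / 2)).
  have -> : \int[P]_w ((cos (cen p w) - k) * cos (cen q w)) =
      1 * \int[P]_w (cos (cen p w) * cos (cen q w)) + - k * \int[P]_w cos (cen q w).
    by apply: lin2 => //; [exact: bmeasM|move=> w; ring].
  rewrite (@lin2 _ _ _ 2^-1 2^-1 (bcos (p + q)) (bcos (p - q))); last first.
    by move=> w; rewrite centeredD centeredB cosB cosD; field.
  rewrite !Rintegral_cos_centered eD eB.
  have -> : expR (- ((cov p p + cov q q) / 2)) = k * expR (- (cov q q / 2)).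
    by rewrite /k -expRD; congr expR; field.
  by field.
- pose k := expR (- (cov p p / 2)).
  have -> : \int[P]_w ((cos (cen p w) - k) * sin (cen q w)) =
      1 * \int[P]_w (cos (cen p w) * sin (cen q w)) + - k * \int[P]_w sin (cen q w).
    by apply: lin2 => //; [exact: bmeasM|move=> w; ring].
  rewrite (@lin2 _ _ _ 2^-1 (- 2^-1) (bsin (p + q)) (bsin (p - q))); last first.
    by move=> w; rewrite centeredD centeredB sinB sinD; field.
  by rewrite !Rintegral_sin_centered !(mulr0, addr0).
- rewrite (@lin2 _ _ _ 2^-1 2^-1 (bsin (p + q)) (bsin (p - q))); last first.
    by move=> w; rewrite centeredD centeredB sinB sinD; field.
  by rewrite !Rintegral_sin_centered !(mulr0, addr0).
- rewrite (@lin2 _ _ _ 2^-1 (- 2^-1) (bcos (p - q)) (bcos (p + q))); last first.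
    by move=> w; rewrite centeredB centeredD cosB cosD; field.
  by rewrite !Rintegral_cos_centered eD eB mulNr subrr.
Qed.

(** The phases restore the means, which turns statements on centered combinations into statements on
    [lin]. *)
Lemma uncorrelated_trig_orth_shift p q (b c : R) : cov p q = 0 ->
  trig_orth P (fun w => cos (cen p w + b) - \int[P]_x cos (cen p x + b))
    (fun w => cen q w + c) /\
  trig_orth P (fun w => sin (cen p w + b) - \int[P]_x sin (cen p x + b))
    (fun w => cen q w + c).
Proof.
move=> pq0; have [oc os] := uncorrelated_trig_orth pq0.
have mc := measurable_centered q.
pose k := expR (- (cov p p / 2)).
have bk : bmeas (fun w => cos (cen p w) - k) by apply: bmeasB (bmeas_cst _ _).
have Ec : \int[P]_x cos (cen p x + b) = k * cos b.
  rewrite (@lin2 _ _ _ (cos b) (- sin b) (bcos p) (bsin p)) => [|w]; last first.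
    by rewrite cosD; ring.
  by rewrite Rintegral_cos_centered Rintegral_sin_centered mulr0 addr0 mulrC.
have Es : \int[P]_x sin (cen p x + b) = k * sin b.
  rewrite (@lin2 _ _ _ (sin b) (cos b) (bcos p) (bsin p)) => [|w]; last first.
    by rewrite sinD; ring.
  by rewrite Rintegral_cos_centered Rintegral_sin_centered mulr0 addr0 mulrC.
split; apply: trig_orth_shift => //.
- by apply: bmeasB (bmeas_cst _ _); apply: bmeas_cos; exact: measurable_funD (measurable_centered p) _.
- rewrite (_ : (fun w => _) = (fun w => cos b * (cos (cen p w) - k) + - sin b * sin (cen p w))).
    exact: trig_orth_linear.
  by apply/funext => w; rewrite Ec cosD; ring.
- by apply: bmeasB (bmeas_cst _ _); apply: bmeas_sin; exact: measurable_funD (measurable_centered p) _.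
- rewrite (_ : (fun w => _) = (fun w => sin b * (cos (cen p w) - k) + cos b * sin (cen p w))).
    exact: trig_orth_linear.
  by apply/funext => w; rewrite Es sinD; ring.
Qed.

End gaussian_process_covariance.

(** * From negative association to nonpositive covariances *)

Section threshold_levels.
Context (R : realType) (a t b r x z : R).
Hypothesis r0 : 0 < r.

(** Here [x] stands for [p], [z] for the remainder and [z + r * x] for [q]. The event
    [b <= z + r * x] contains [b - r * a <= z] when [x] is in [[a, t[], and contains
    [b - r * t <= z] when [t <= x]. *)
Lemma level_above : a <= t ->
  (b - r * a <= z)%R%:R * (a <= x)%R%:R - (b - r * a <= z)%R%:R * (t <= x)%R%:R +
  (b - r * t <= z)%R%:R * (t <= x)%R%:R <=
  (a <= x)%R%:R * (b <= z + r * x)%R%:R :> R.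
Proof.
move=> at_; have [tx|xt] := leP t x.
  have ax : a <= x by exact: le_trans tx.
  rewrite ax !mulr1 subrr add0r mul1r.
  have := ler_wpM2l (ltW r0) tx.
  by move=> h; case: (leP (b - r * t) z) => h1; case: (leP b (z + r * x)) => h2 /=; lra.
rewrite !mulr0 subr0 addr0; have [ax|xa] := leP a x; last by rewrite mulr0 mul0r.
rewrite mulr1 mul1r; have := ler_wpM2l (ltW r0) ax.
by move=> h; case: (leP (b - r * a) z) => h1; case: (leP b (z + r * x)) => h2 /=; lra.
Qed.

(** The event [b <= z + r * x] is contained in [b - r * a <= z] when [x] is in [[t, a[], and in
    [b - r * t <= z] when [x < t]. *)
Lemma level_below : t <= a ->
  (b <= z + r * x)%R%:R - (a <= x)%R%:R * (b <= z + r * x)%R%:R <=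
  (b - r * a <= z)%R%:R * (t <= x)%R%:R - (b - r * a <= z)%R%:R * (a <= x)%R%:R +
  (b - r * t <= z)%R%:R - (b - r * t <= z)%R%:R * (t <= x)%R%:R :> R.
Proof.
move=> ta; have [tx|xt] := leP t x; last first.
  have /negbTE -> : ~~ (a <= x) by rewrite -ltNge (lt_le_trans xt).
  rewrite !mulr0 mul0r !subr0 add0r.
  have := ler_wpM2l (ltW r0) (ltW xt).
  by move=> h; case: (leP (b - r * t) z) => h1; case: (leP b (z + r * x)) => h2 /=; lra.
rewrite !mulr1 -addrA subrr addr0; have [ax|xa] := leP a x.
  by rewrite mul1r mulr1 !subrr.
rewrite mul0r mulr0 !subr0; have := ler_wpM2l (ltW r0) (ltW xa).
by move=> h; case: (leP (b - r * a) z) => h1; case: (leP b (z + r * x)) => h2 /=; lra.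
Qed.

(** Negative association reads [(1 - A) * AB <= A * (B - AB)]. Inserting the bounds on [AB] and
    [B - AB] cancels all but [(1 - A) * y * (Gt - Ga) <= 0]. In [levels_lower] the remaining term is
    [A * (1 - y) * (Ga - Gt)]. *)
Lemma levels_upper (A AB B Ga Gt y : R) : 0 < A -> A < 1 -> 0 < y ->
  AB <= A * B -> Ga * A - Ga * y + Gt * y <= AB ->
  B - AB <= Ga * A - Ga * A + Ga - Ga * A -> Gt <= Ga.
Proof.
move=> A0 A1 y0 NA h1 h2; have A1' : 0 < 1 - A by rewrite subr_gt0.
have {}h1 := ler_wpM2l (ltW A1') h1.
have {}h2 := ler_wpM2l (ltW A0) h2.
rewrite leNgt; apply/negP => lt.
have := mulr_gt0 (mulr_gt0 A1' y0) (eqbRL (subr_gt0 _ _) lt); lra.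
Qed.

Lemma levels_lower (A AB B Ga Gt y : R) : 0 < A -> A < 1 -> y < 1 ->
  AB <= A * B -> Ga * A - Ga * A + Ga * A <= AB ->
  B - AB <= Ga * y - Ga * A + Gt - Gt * y -> Ga <= Gt.
Proof.
move=> A0 A1 y1 NA h1 h2; have A1' : 0 < 1 - A by rewrite subr_gt0.
have {}h1 := ler_wpM2l (ltW A1') h1.
have {}h2 := ler_wpM2l (ltW A0) h2.
rewrite leNgt; apply/negP => lt.
have := mulr_gt0 (mulr_gt0 A0 (eqbRL (subr_gt0 _ _) y1)) (eqbRL (subr_gt0 _ _) lt).
lra.
Qed.

(** Solves [r * shift = n + |b| + r * |a|], so that moving the level [a] by it pushes [b - r * a]
    past [n] or [- n]. *)
Definition level_shift (n : nat) : R := (n%:R + `|b| + r * `|a|) / r.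

Lemma level_shift_ge0 n : 0 <= level_shift n.
Proof. by rewrite divr_ge0 ?(ltW r0)// !addr_ge0// mulr_ge0// ltW. Qed.

Let level_shiftE n : r * level_shift n = n%:R + `|b| + r * `|a|.
Proof. by rewrite mulrC divfK// gt_eqF. Qed.

Lemma level_shift_add n : b - r * (a + level_shift n) <= - n%:R.
Proof.
rewrite mulrDr level_shiftE; have := ler_norm b; have := ler_norm (- (r * a)).
by rewrite normrN normrM (gtr0_norm r0); lra.
Qed.

Lemma level_shift_sub n : n%:R <= b - r * (a - level_shift n).
Proof.
rewrite mulrBr level_shiftE; have := ler_norm (- b); have := ler_norm (r * a).
by rewrite normrN normrM (gtr0_norm r0); lra.
Qed.

End threshold_levels.

Section nonpositive_correlation.
Context d (T : measurableType d) (R : realType) (P : probability T R).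
Variable Z : nat -> {RV P >-> R}.
Hypothesis gZ : gaussian_process Z.
Implicit Types p q : {poly R}.

Local Notation L := (lin (fun i => Z i : T -> R)).
Local Notation cen := (centered Z).
Local Notation pr A := (\int[P]_w (\1_A w : R)).

Let up p t : set T := [set w | t <= cen p w].

Let mcen p : measurable_fun [set: T] (cen p).
Proof. exact: measurable_centered. Qed.

Let mup p t : measurable (up p t).
Proof. exact: measurable_ge_set. Qed.

Let bup p t : bmeas (\1_(up p t) : T -> R).
Proof. exact: bmeas_indic. Qed.

(** Fourier uniqueness twice: first in [q], with the centered trigonometric functions of [p] as
    weights, then in [p], with the centered indicator of [up q t] as weight. *)
Lemma uncorrelated_indep p q s t : cov Z p q = 0 ->
  \int[P]_w (\1_(up p s) w * \1_(up q t) w) = pr (up p s) * pr (up q t).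
Proof.
move=> pq0.
pose psi w := \1_(up q t) w - pr (up q t).
have bpsi : bmeas psi by apply: bmeasB (bmeas_cst _ _).
(* A covariance may be computed by centering either factor; this exchanges the roles of weight and
   test function. *)
have key (f : T -> R) : bmeas f ->
    \int[P]_w ((f w - \int[P]_x f x) * \1_(up q t) w) = 0 ->
    \int[P]_w (psi w * f w) = 0.
  move=> bf f0.
  rewrite -[RHS]f0 /psi.
  under eq_Rintegral do rewrite mulrBl.
  under [in RHS]eq_Rintegral do rewrite mulrBl.
  rewrite !Rintegral_bmeasB; last 4 first.
  - exact: bmeasM.
  - exact: bmeasM (bmeas_cst _ _) _.
  - exact: bmeasM.
  - exact: bmeasM (bmeas_cst _ _) _.
  rewrite !Rintegral_bmeasZ// (mulrC (pr _)); congr (_ - _).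
  by apply: eq_Rintegral => w _; rewrite mulrC.
have orth u : trig_orth P psi (fun w => u * cen p w).
  have uv0 v : cov Z (u *: p) (v *: q) = 0.
    by rewrite (covZl gZ) covC (covZl gZ) covC pq0 !mulr0.
  have h v := uncorrelated_trig_orth gZ (uv0 v).
  have E v : cen (v *: q) = (fun w => v * cen q w).
    by apply/funext => w; rewrite (centeredZ gZ).
  have Eu : cen (u *: p) = (fun w => u * cen p w).
    by apply/funext => w; rewrite (centeredZ gZ).
  have bc : bmeas (fun w => cos (u * cen p w)).
    by apply: bmeas_cos; exact: measurable_funM.
  have bs : bmeas (fun w => sin (u * cen p w)).
    by apply: bmeas_sin; exact: measurable_funM.
  split; apply: key => //.
  - apply: trig_orth_ge => // [|v]; first exact: bmeasB (bmeas_cst _ _).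
    have [+ _] := h v; rewrite E.
    by rewrite -(Rintegral_cos_centered gZ) Eu.
  - apply: trig_orth_ge => // [|v]; first exact: bmeasB (bmeas_cst _ _).
    have [_] := h v; rewrite E.
    rewrite (_ : \int[P]_x _ = 0); last first.
      by rewrite -(Rintegral_sin_centered gZ (u *: p)) Eu.
    by rewrite Eu; congr (trig_orth P _ _); apply/funext => w; rewrite subr0.
have := trig_orth_ge bpsi (mcen p) orth s.
rewrite /psi; under eq_Rintegral do rewrite mulrBl.
rewrite Rintegral_bmeasB; last 2 first.
- exact: bmeasM (bup _ _) (bup _ _).
- exact: bmeasM (bmeas_cst _ _) (bup _ _).
rewrite Rintegral_bmeasZ; last exact: bup.
move=> /subr0_eq h; rewrite mulrC -h.
by apply: eq_Rintegral => w _; rewrite mulrC.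
Qed.

Let pr_up_cvg0 p (t_ : nat -> R) : (forall n, n%:R <= t_ n) ->
  pr (up p (t_ n)) @[n --> \oo] --> (0 : R).
Proof.
move=> tn; rewrite -(Rintegral_prob_cst P 0).
apply: (@cvg_Rintegral_bmeas _ _ _ _ 1 (fun n => \1_(up p (t_ n)))) => [n|n x|x].
- exact: measurable_indic.
- by rewrite indicE; case: (_ \in _); rewrite ?normr1// normr0.
- apply: cvg_near_cst; near=> n.
  rewrite /up indic_boolE; case: leP => // h; exfalso.
  have : cen p x < n%:R by near: n; exact: nbhs_infty_gtr.
  by have := tn n; lra.
Unshelve. all: by end_near. Qed.

Let pr_up_cvg1 p (t_ : nat -> R) : (forall n, t_ n <= - n%:R) ->
  pr (up p (t_ n)) @[n --> \oo] --> (1 : R).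
Proof.
move=> tn; rewrite -(Rintegral_prob_cst P 1).
apply: (@cvg_Rintegral_bmeas _ _ _ _ 1 (fun n => \1_(up p (t_ n)))) => [n|n x|x].
- exact: measurable_indic.
- by rewrite indicE; case: (_ \in _); rewrite ?normr1// normr0.
- apply: cvg_near_cst; near=> n.
  rewrite /up indic_boolE; case: leP => // h; exfalso.
  have : - cen p x < n%:R by near: n; exact: nbhs_infty_gtr.
  by have := tn n; lra.
Unshelve. all: by end_near. Qed.

Let fine_prob_gt0 (A : set T) : measurable A -> (0 < P A)%E -> 0 < pr A.
Proof.
move=> mA PA; rewrite Rintegral_indicE// fine_gt0// PA/=.
by rewrite (le_lt_trans (probability_le1 P mA))// ltry.
Qed.

Let pr_up_gt0 p t : cov Z p p != 0 -> 0 < pr (up p t) /\ pr (up p t) < 1.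
Proof.
move=> p0; have [_ [_ _ h]] := gaussian_centered gZ p.
have [h1 h2] := h p0 (t + \int[P]_x L p x).
have E1 : [set w | t + \int[P]_x L p x <= L p w] = up p t.
  by apply/seteqP; split=> w; rewrite /up /centered/= lerBrDr.
have E2 : [set w | L p w < t + \int[P]_x L p x] = ~` up p t.
  apply/seteqP; split=> w; rewrite /up /centered/= lerBrDr ltNge.
    by move/negP.
  by move=> /negP.
rewrite E1 in h1; rewrite E2 in h2.
split; first exact: fine_prob_gt0.
have := fine_prob_gt0 (measurableC (mup p t)) h2.
have -> : pr (~` up p t) = 1 - pr (up p t).
  rewrite -(Rintegral_prob_cst P 1) -Rintegral_bmeasB//; last exact: bmeas_cst.
  apply: eq_Rintegral => w _; rewrite !indicE in_setC.
  by case: (_ \in _); rewrite /= ?subrr ?subr0.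
lra.
Qed.

(* Write [q = r p + (uncorrelated remainder)] with [r > 0]: given [cen p], the
   event [up q b] has conditional probability nondecreasing in [cen p], tending
   to 0 and 1 at the two ends. *)
Lemma positively_correlated_up p q a b : 0 < cov Z p q ->
  pr (up p a) * pr (up q b) < \int[P]_w (\1_(up p a) w * \1_(up q b) w).
Proof.
move=> c0; rewrite ltNge; apply/negP => NA.
have V0 : 0 < cov Z p p.
  rewrite lt_neqAle cov_ge0 andbT eq_sym; apply/negP => /eqP V0.
  have := semi_cauchy_schwarz (covC Z) (covDl gZ) (covZl gZ) (cov_ge0 Z) p q.
  by rewrite V0 mul0r leNgt exprn_gt0.
(* The regression coefficient, which makes the remainder [z] uncorrelated with [p]. *)
pose r := cov Z p q / cov Z p p.
have r0 : 0 < r := divr_gt0 c0 V0.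
pose z := q - r *: p.
have zp0 : cov Z z p = 0.
  rewrite /z -scaleN1r (covDl gZ) 2!(covZl gZ) (covC _ q p) /r divfK ?gt_eqF//.
  by rewrite mulN1r subrr.
have qE w : cen q w = cen z w + r * cen p w.
  by rewrite /z (centeredB gZ) (centeredZ gZ) subrK.
pose G t := up z (b - r * t).
have indep s t : \int[P]_w (\1_(G t) w * \1_(up p s) w) = pr (G t) * pr (up p s).
  exact: uncorrelated_indep.
have bG t : bmeas (\1_(G t) : T -> R) by exact: bup.
have [A0 A1] := pr_up_gt0 a (lt0r_neq0 V0).
set A := up p a in NA A0 A1 *; set B := up q b in NA *.
have bA : bmeas (\1_A : T -> R) by exact: bup.
have bB : bmeas (\1_B : T -> R) by exact: bup.
have iE p' t' w : \1_(up p' t') w = (t' <= cen p' w)%R%:R :> R by exact: indic_boolE.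
have bt t : bmeas (\1_(up p t) : T -> R) by exact: bup.
pose AB := \int[P]_w (\1_A w * \1_B w).
have above t : a <= t ->
    pr (G a) * pr A - pr (G a) * pr (up p t) + pr (G t) * pr (up p t) <= AB.
  move=> at_; rewrite -!indep /AB -Rintegral_bmeasB -?Rintegral_bmeasD;
    try solve_bmeas.
  apply: Rintegral_bmeas_le => [||w];
    try solve_bmeas.
  by rewrite !iE qE; exact: level_above.
have below t : t <= a -> pr B - AB <=
    pr (G a) * pr (up p t) - pr (G a) * pr A + pr (G t) - pr (G t) * pr (up p t).
  move=> ta; rewrite -!indep /AB -!Rintegral_bmeasB -?Rintegral_bmeasD -?Rintegral_bmeasB;
    try solve_bmeas.
  apply: Rintegral_bmeas_le => [||w];
    try solve_bmeas.
  by rewrite !iE qE; exact: level_below.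
have upper t : a <= t -> pr (G t) <= pr (G a).
  move=> /above h1; have h2 := below a (lexx a).
  have [y0 _] := pr_up_gt0 t (lt0r_neq0 V0).
  exact: levels_upper A0 A1 y0 NA h1 h2.
have lower t : t <= a -> pr (G a) <= pr (G t).
  move=> /below h2; have h1 := above a (lexx a).
  have [_ y1] := pr_up_gt0 t (lt0r_neq0 V0).
  exact: levels_lower A0 A1 y1 NA h1 h2.
(* As [t] tends to infinity [pr (G t)] tends to 1, yet [upper] keeps it at most [pr (G a)]; the
   other end forces [pr (G a) <= 0]. *)
have Ga1 : 1 <= pr (G a).
  have h := @pr_up_cvg1 z _ (level_shift_add a b r0).
  apply: (cvgr_to_le h); apply: nearW => n.
  by apply: upper; rewrite lerDl level_shift_ge0.
have Ga0 : pr (G a) <= 0.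
  have h := @pr_up_cvg0 z _ (level_shift_sub a b r0).
  apply: (cvgr_to_ge h); apply: nearW => n.
  by apply: lower; rewrite gerDl oppr_le0 level_shift_ge0.
by have := le_trans Ga1 Ga0; rewrite ler10.
Qed.

(** Two single coordinates suffice as test functions: [threshold Z a k] is the indicator of an event
    [up 'X^k], its level shifted by the mean of [Z k]. *)
Lemma negatively_associated_cov_le0 (a : nat -> R) i j :
  negatively_associated P (threshold Z a) -> i != j -> cov Z 'X^i 'X^j <= 0.
Proof.
move=> NA ij; rewrite leNgt; apply/negP => c0.
have mprojection k : measurable_fun [set: seq_space R] (fun x : seq_space R => x k).
  move=> _ B mB; apply: sub_sigma_algebra; exists k => //.
  by exists B.
pose Xi k := threshold Z a k.
have XE k w : Xi k w = \1_(up 'X^k (a k - \int[P]_x L 'X^k x)) w.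
  rewrite /Xi /threshold; congr (\1__ _); apply/seteqP; split=> x /=;
    by rewrite /up /centered/= linXn lerD2r.
have bX k : bmeas (Xi k).
  by rewrite (funext (XE k)); exact: bup.
have EE (f : T -> R) : bmeas f -> ('E_P[f] = (\int[P]_w f w)%R%:E)%E.
  move=> bf; rewrite unlock /Rintegral fineK//.
  by apply: integrable_fin_num => //; exact: bmeas_integrable.
have := NA [set i] [set j] (fun x => x i) (fun x => x j).
move=> /(_ _ (mprojection i) (mprojection j)).
have -> : [set i] `&` [set j] = set0.
  by apply/seteqP; split=> k //= [-> /eqP]; rewrite (negbTE ij).
move=> /(_ erefl (fun x y h => h i) (fun x y h => h j)).
have di : depends_only_on [set i] (fun x : nat -> R => x i) by move=> x y; apply.
have dj : depends_only_on [set j] (fun x : nat -> R => x j) by move=> x y; apply.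
move=> /(_ di dj (bmeas_integrable P (bX i)) (bmeas_integrable P (bX j))
  (bmeas_integrable P (bmeasM (bX i) (bX j)))).
rewrite (EE _ (bX i)) (EE _ (bX j)) (EE _ (bmeasM (bX i) (bX j))) -EFinM lee_fin.
have Ei : \int[P]_w Xi i w = pr (up 'X^i (a i - \int[P]_x L 'X^i x)).
  by apply: eq_Rintegral => w _; rewrite XE.
have Ej : \int[P]_w Xi j w = pr (up 'X^j (a j - \int[P]_x L 'X^j x)).
  by apply: eq_Rintegral => w _; rewrite XE.
rewrite Ei Ej; under eq_Rintegral do rewrite !XE.
by rewrite leNgt positively_correlated_up.
Qed.

End nonpositive_correlation.

(** * Tail events *)

Section lipschitz_trigonometric.
Context (R : realType).

Lemma derive_le1_lipschitz (f f' : R -> R) :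
  (forall x, is_derive x (1 : R) f (f' x)) -> (forall x, `|f' x| <= 1) ->
  forall x y, `|f x - f y| <= `|x - y|.
Proof.
move=> df f'1; suff H x y : x < y -> `|f y - f x| <= `|y - x|.
  move=> x y; have [xy|yx|->] := ltgtP x y; last by rewrite !subrr normr0.
    by rewrite distrC (distrC x); exact: H.
  exact: H.
move=> xy; have cf : {within `[x, y], continuous f}.
  apply: continuous_subspaceT => z; apply: differentiable_continuous.
  by apply/derivable1_diffP; have [] := df z.
have [c _ ->] := MVT xy (fun z _ => df z) cf.
by rewrite normrM ler_piMl.
Qed.

Lemma cos_lipschitz (x y : R) : `|cos x - cos y| <= `|x - y|.
Proof.
apply: (@derive_le1_lipschitz _ (fun x => - sin x)) => z.
by rewrite normrN sin_max.
Qed.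

Lemma sin_lipschitz (x y : R) : `|sin x - sin y| <= `|x - y|.
Proof. by apply: (@derive_le1_lipschitz _ (@cos R)) => z; exact: cos_max. Qed.

End lipschitz_trigonometric.

Section approximation.
Context d (T : measurableType d) (R : realType) (P : probability T R).
Variable Z : nat -> {RV P >-> R}.
Variable a : nat -> R.

Let mZ i : measurable_fun [set: T] (Z i : T -> R).
Proof. exact: measurable_funP. Qed.

Definition threshold_event := tevent (fun i => Z i : T -> R) a.

Lemma measurable_threshold_event n N B : bdepends n N B ->
  measurable (threshold_event B).
Proof. exact: measurable_tevent. Qed.

(** The integral is the probability of the symmetric difference. For fixed [n] these sets form a
    sigma-algebra, unlike the finite-dimensional events themselves. *)
Definition approximable n (E : set T) := measurable E /\
  forall e : R, 0 < e -> exists N B, bdepends n N B /\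
    \int[P]_w `|\1_E w - \1_(threshold_event B) w| <= e.

Let bdist (E F : set T) : measurable E -> measurable F ->
  bmeas (fun w => `|\1_E w - \1_F w| : R).
Proof. by move=> mE mF; apply: bmeas_norm; apply: bmeasB; exact: bmeas_indic. Qed.

Let approximable_self n N B : bdepends n N B -> approximable n (threshold_event B).
Proof.
move=> hB; split; first exact: measurable_threshold_event hB.
move=> e e0; exists N, B; split => //.
under eq_Rintegral do rewrite subrr normr0.
by rewrite Rintegral_prob_cst ltW.
Qed.

Let approximable0 n : approximable n set0.
Proof.
rewrite (_ : set0 = threshold_event (fun=> false)).
  exact: (@approximable_self n n).
by apply/seteqP; split.
Qed.

Let approximableC n E : approximable n E -> approximable n ([set: T] `\` E).
Proof.
rewrite setTD => -[mE hE]; split=> [|e e0]; first exact: measurableC.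
have [N [B [hB le]]] := hE e e0; exists N, (fun b => ~~ B b); split.
  by move=> b b' bb'; rewrite (hB b b').
apply: le_trans le; rewrite le_eqVlt; apply/orP; left; apply/eqP.
apply: eq_Rintegral => w _.
have -> : threshold_event (fun b => ~~ B b) = ~` threshold_event B.
  by apply/seteqP; split=> x /negP.
rewrite !indicE !in_setC; case: (_ \in _); case: (_ \in _);
  by rewrite /= ?subrr ?subr0 ?sub0r ?normrN.
Qed.

Let approximableU n E F : approximable n E -> approximable n F ->
  approximable n (E `|` F).
Proof.
move=> [mE hE] [mF hF]; split=> [|e e0]; first exact: measurableU.
have e2 : 0 < e / 2 by rewrite divr_gt0.
have [N [B [hB leB]]] := hE _ e2; have [N' [B' [hB' leB']]] := hF _ e2.
exists (maxn N N'), (fun b => B b || B' b); split.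
  move=> b b' bb'; rewrite (hB b b') ?(hB' b b')// => i hi; apply: bb';
    by clear -hi; lia.
have mB := measurable_threshold_event hB.
have mB' := measurable_threshold_event hB'.
have -> : threshold_event (fun b => B b || B' b) =
    threshold_event B `|` threshold_event B'.
  by apply/seteqP; split=> x /orP.
rewrite [leRHS]splitr; apply: le_trans (lerD leB leB').
rewrite -Rintegral_bmeasD; [|exact: bdist..].
apply: Rintegral_bmeas_le; [by apply: bdist; exact: measurableU|by apply: bmeasD; exact: bdist|].
move=> w; rewrite !indicE !in_setU.
by case: (w \in E); case: (w \in F); case: (w \in threshold_event B);
  case: (w \in threshold_event B'); rewrite /= ?subrr ?subr0 ?sub0r ?normrN ?normr0 ?normr1; lra.
Qed.

Let approximable_bigcup n (E : nat -> set T) : (forall k, approximable n (E k)) ->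
  approximable n (\bigcup_k E k).
Proof.
move=> hE; have mE k : measurable (E k) by have [] := hE k.
have mU : measurable (\bigcup_k E k) by exact: bigcup_measurable.
split=> // e e0.
have hU K : approximable n (\big[setU/set0]_(k < K) E k).
  elim: K => [|K ih]; first by rewrite big_ord0.
  by rewrite big_ord_recr/=; exact: approximableU.
have cv : \int[P]_w `|\1_(\bigcup_k E k) w - \1_(\big[setU/set0]_(k < K) E k) w|
    @[K --> \oo] --> (0 : R).
  rewrite -(Rintegral_prob_cst P 0).
  apply: (@cvg_Rintegral_bmeas _ _ _ _ 1
    (fun K w => `|\1_(\bigcup_k E k) w - \1_(\big[setU/set0]_(k < K) E k) w|)) => [K|K w|w].
  - by have [mK _] := hU K; have [] := bdist mU mK.
  - rewrite normr_id !indicE.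
    by case: (_ \in _); case: (_ \in _); rewrite /= ?subrr ?subr0 ?sub0r ?normrN ?normr0 ?normr1.
  - have [[k _ Ek]|nE] := pselect ((\bigcup_k E k) w); apply: cvg_near_cst.
      exists k.+1 => // K /= kK; rewrite !indicE mem_set; last by exists k.
      by rewrite mem_set ?subrr ?normr0//; rewrite -bigcup_mkord; exists k.
    apply: nearW => K; rewrite !indicE !memNset ?subrr ?normr0//.
    by rewrite -bigcup_mkord => -[k _ Ek]; apply: nE; exists k.
have e2 : 0 < e / 2 by rewrite divr_gt0.
have [K KE] : exists K, \int[P]_w `|\1_(\bigcup_k E k) w - \1_(\big[setU/set0]_(k < K) E k) w| <= e / 2.
  by have [K _ /(_ K (leqnn K))] := cvgr_le _ cv _ e2; exists K.
have [mK hK] := hU K; have [N [B [hB leB]]] := hK _ e2.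
exists N, B; split => //; have mB := measurable_threshold_event hB.
rewrite [leRHS]splitr; apply: le_trans (lerD KE leB).
rewrite -Rintegral_bmeasD; [|exact: bdist..].
apply: Rintegral_bmeas_le; [exact: bdist|by apply: bmeasD; exact: bdist|].
by move=> w; exact: ler_distD.
Qed.

Lemma sigma_coord_gen_approximable n E :
  <<s coord_gen (threshold Z a) [set i | (n <= i)%N] >> E -> approximable n E.
Proof.
apply: smallest_sub; first split.
- exact: approximable0.
- by move=> A; exact: approximableC.
- by move=> A; exact: approximable_bigcup.
move=> _ [i /= ni [C mC <-]].
(* The threshold variable takes only the values 0 and 1, so membership of these two points in [C]
   decides the preimage. *)
pose B (b : nat -> bool) := if b i then `[< C 1 >] else `[< C 0 >].
rewrite (_ : _ `&` _ = threshold_event B).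
  apply: (@approximable_self n i.+1) => b b' bb'.
  by rewrite /B bb'// ni ltnSn.
rewrite setTI /threshold_event /tevent /threshold.
apply/seteqP; split=> w; rewrite /preimage/= indic_boolE /B;
  by case: ifPn => _ /asboolP.
Qed.

End approximation.

Section tail_orthogonality.
Context d (T : measurableType d) (R : realType) (P : probability T R).
Variables (Z : nat -> {RV P >-> R}) (a : nat -> R).
Hypothesis gZ : gaussian_process Z.
Hypothesis Z_le0 : forall i j, i != j -> cov Z 'X^i 'X^j <= 0.

Local Notation L := (lin (fun i => Z i : T -> R)).
Local Notation cen := (centered Z).
Local Notation pr A := (\int[P]_w (\1_A w : R)).

Let mZ i : measurable_fun [set: T] (Z i : T -> R).
Proof. exact: measurable_funP. Qed.

Let mL p : measurable_fun [set: T] (L p).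
Proof. by apply: measurable_lin => i; exact: measurable_funP. Qed.

Let mcen p : measurable_fun [set: T] (cen p).
Proof. exact: measurable_centered. Qed.

Lemma integrable_norm_centered p :
  P.-integrable [set: T] (EFin \o (fun w => `|cen p w|)).
Proof.
have [[iB _ _ _] _] := gaussian_centered gZ p.
have := integrable_abse iB.
by apply: eq_integrable.
Qed.

(** Integrates [|x| <= e / 2 + x ^ 2 / (2 * e)], which replaces the Cauchy-Schwarz inequality for
    integrals. *)
Lemma Rintegral_norm_centered_le p e : 0 < e -> cov Z p p <= e ^+ 2 ->
  \int[P]_w `|cen p w| <= e.
Proof.
move=> e0 pe; have i2 := integrable_centered_sq gZ p.
have iB : P.-integrable [set: T] (fun w => (2^-1 * e^-1 * cen p w ^+ 2)%:E).
  exact: (integrableZl measurableT (2^-1 * e^-1) i2).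
have bc := bmeas_integrable P (bmeas_cst T (e / 2)).
have iD : P.-integrable [set: T] (fun w => (e / 2 + 2^-1 * e^-1 * cen p w ^+ 2)%:E).
  exact: (integrableD measurableT bc iB).
have ptw w : `|cen p w| <= e / 2 + 2^-1 * e^-1 * cen p w ^+ 2.
  rewrite -(real_normK (num_real (cen p w))); move: `|cen p w| => x.
  rewrite -subr_ge0.
  have -> : e / 2 + 2^-1 * e^-1 * x ^+ 2 - x = 2^-1 * e^-1 * (x - e) ^+ 2.
    by field; rewrite gt_eqF.
  by rewrite mulr_ge0 ?sqr_ge0// mulr_ge0 ?invr_ge0 ?(ltW e0).
have iN := integrable_norm_centered p.
apply: le_trans (le_Rintegral measurableT iN iD (fun w _ => ptw w)) _.
rewrite RintegralD// Rintegral_prob_cst RintegralZl//.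
have -> : \int[P]_w (cen p w ^+ 2) = cov Z p p.
  by apply: eq_Rintegral => w _; rewrite expr2.
apply: le_trans (_ : e / 2 + 2^-1 * e^-1 * e ^+ 2 <= _).
  by rewrite lerD2l ler_wpM2l// mulr_ge0 ?invr_ge0 ?(ltW e0).
by rewrite le_eqVlt; apply/orP; left; apply/eqP; field; rewrite gt_eqF.
Qed.

Let norm_indic_subr_le1 (E : set T) w : measurable E -> `|\1_E w - pr E| <= 1.
Proof.
move=> mE; have p0 : 0 <= pr E by apply: Rintegral_ge0 => x _; rewrite indicE.
have p1 : pr E <= 1.
  rewrite Rintegral_indicE// -lee_fin fineK ?fin_num_measure//.
  exact: probability_le1.
move: (pr E) p0 p1 => p p0 p1; rewrite indicE.
by case: (_ \in _); rewrite ler_norml /=; lra.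
Qed.

Let eq0_of_small (x : R) : (forall e, 0 < e -> `|x| <= 3 * e) -> x = 0.
Proof.
move=> h; apply/eqP; rewrite -normr_eq0 eq_le normr_ge0 andbT leNgt.
by apply/negP => x0; have := h (`|x| / 4); rewrite divr_gt0// => /(_ isT); lra.
Qed.

(* [u = h + (u - h)] with [h] the projection of [u] on a far tail span: the
   first summand is small and the second one is independent of a
   finite-dimensional event approximating [E]. *)
Lemma tail_event_orth (E : set T) (g : R -> R) u :
  measurable_fun [set: R] g -> (forall x, `|g x| <= 1) ->
  (forall x y, `|g x - g y| <= `|x - y|) ->
  (forall p q b c, cov Z p q = 0 ->
    trig_orth P (fun w => g (cen p w + b) - \int[P]_x g (cen p x + b))
      (fun w => cen q w + c)) ->
  (forall n, approximable Z a n E) ->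
  \int[P]_w ((\1_E w - pr E) * g (L u w)) = 0.
Proof.
move=> mg g1 glip orth hE; apply: eq0_of_small => e e0.
(* [n] is fixed before [N]: the projections on all windows from [n] on are small, and the
   approximation of [E] then selects the window. *)
have [n hn] := tail_projection_small (covC Z) (covDl gZ) (covZl gZ) (cov_ge0 Z)
  Z_le0 u (exprn_gt0 2 e0).
have [mE /(_ e e0) [N [B [hB EB]]]] := hE n.
pose F := threshold_event Z a B.
have mF : measurable F by exact: measurable_threshold_event hB.
have [h sh oh] := exists_projection (covC Z) (covDl gZ) (covZl gZ) (cov_ge0 Z) n N u.
have he : \int[P]_w `|cen h w| <= e.
  exact: Rintegral_norm_centered_le (ltW (hn N h sh oh)).
pose b : R := \int[P]_x L u x.
pose W w := cen (u - h) w + b.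
have LW w : L u w - W w = cen h w.
  rewrite /W (centeredB gZ) /centered /b; ring.
have mW : measurable_fun [set: T] W by exact: measurable_funD.
have bg (f : T -> R) : measurable_fun [set: T] f -> bmeas (fun w => g (f w)).
  by move=> mf; split; [exact: measurableT_comp|exists 1].
have bE := bmeas_indic R mE; have bF := bmeas_indic R mF.
have bpsi : bmeas (fun w => g (W w) - \int[P]_x g (W x)).
  by apply: bmeasB (bmeas_cst _ _); exact: bg.
(* [u - h] is uncorrelated with the whole window on which [F] depends, so Fourier uniqueness applies
   to the centered weight [g (W w)]. *)
have psiF : \int[P]_w ((g (W w) - \int[P]_x g (W x)) * \1_F w) = 0.
  apply: (trig_orth_tevent a mZ bpsi _ hB) => v sv.
  have := orth (u - h) v b (\int[P]_x L v x) (oh v sv).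
  by congr (trig_orth P _ _); apply/funext => w; rewrite /centered subrK.
have FW : \int[P]_w ((\1_F w - pr F) * g (W w)) = 0.
  have bgW := bg _ mW.
  rewrite -[RHS]psiF; under eq_Rintegral do rewrite mulrBl.
  under [in RHS]eq_Rintegral do rewrite mulrBl.
  rewrite !Rintegral_bmeasB; last 4 first.
  - exact: bmeasM.
  - exact: bmeasM (bmeas_cst _ _) _.
  - exact: bmeasM.
  - exact: bmeasM (bmeas_cst _ _) _.
  rewrite !Rintegral_bmeasZ// (mulrC (pr F)); congr (_ - _).
  by apply: eq_Rintegral => w _; rewrite mulrC.

have bgU : bmeas (fun w => g (L u w)) by exact: bg.
have bgW : bmeas (fun w => g (W w)) by exact: bg.
have bEc : bmeas (fun w => \1_E w - pr E) by apply: bmeasB (bmeas_cst _ _).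
have bFc : bmeas (fun w => \1_F w - pr F) by apply: bmeasB (bmeas_cst _ _).
have bUW : bmeas (fun w => g (L u w) - g (W w)) by exact: bmeasB.
have bEF : bmeas (fun w => \1_E w - \1_F w : R) by exact: bmeasB.
have bD : bmeas (fun w => (\1_E w - \1_F w) - (pr E - pr F)).
  by apply: bmeasB (bmeas_cst _ _).
(* Up to [FW], the error is split in two. Replacing [L u] by [W] costs the mean of [|cen h|], as [g]
   is 1-Lipschitz; replacing [E] by [F] costs [e] for the indicators and [e] for the
   probabilities. *)
have -> : \int[P]_w ((\1_E w - pr E) * g (L u w)) =
    \int[P]_w ((\1_E w - pr E) * (g (L u w) - g (W w))) +
    \int[P]_w (((\1_E w - \1_F w) - (pr E - pr F)) * g (W w)).
  rewrite -[RHS]addr0 -[X in _ = _ + X]FW -!Rintegral_bmeasD;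
    try solve_bmeas.
  by apply: eq_Rintegral => w _; rewrite mulrBr !mulrBl; ring.
have pEF : `|pr E - pr F| <= e.
  rewrite -Rintegral_bmeasB//; apply: le_trans EB.
  by apply: le_normr_Rintegral => //; exact: bmeas_integrable.
have Ec1 w : `|\1_E w - pr E| <= 1 by exact: norm_indic_subr_le1.
have I1 : `|\int[P]_w ((\1_E w - pr E) * (g (L u w) - g (W w)))| <= e.
  apply: le_trans he; apply: le_trans (le_normr_Rintegral _ _) _ => //.
    by apply: bmeas_integrable; exact: bmeasM.
  apply: le_Rintegral => //.
  - by apply: bmeas_integrable; apply: bmeas_norm; exact: bmeasM.
  - exact: integrable_norm_centered.
  - move=> w _; rewrite normrM -LW.
    by apply: le_trans (glip _ _); rewrite ler_piMl.
have I2 : `|\int[P]_w (((\1_E w - \1_F w) - (pr E - pr F)) * g (W w))| <= e + e.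
  apply: le_trans (le_normr_Rintegral _ _) _ => //.
    by apply: bmeas_integrable; exact: bmeasM.
  apply: (@le_trans _ _ (\int[P]_w (`|\1_E w - \1_F w| + e))).
    apply: le_Rintegral => //.
    - by apply: bmeas_integrable; apply: bmeas_norm; exact: bmeasM.
    - by apply: bmeas_integrable; apply: bmeasD (bmeas_cst _ _); exact: bmeas_norm.
    - move=> w _; rewrite normrM.
      apply: (@le_trans _ _ (`|\1_E w - \1_F w - (pr E - pr F)|)).
        by rewrite ler_piMr.
      by apply: le_trans (ler_normB _ _) _; rewrite lerD2l.
  rewrite Rintegral_bmeasD; [|exact: bmeas_norm|exact: bmeas_cst].
  by rewrite Rintegral_prob_cst lerD2r.
apply: le_trans (ler_normD _ _) _; apply: le_trans (lerD I1 I2) _.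
by rewrite addrA -!mulr2n -mulrSr mulr_natl.
Qed.

Lemma tail_event_trig_orth (E : set T) u : (forall n, approximable Z a n E) ->
  trig_orth P (fun w => \1_E w - pr E) (L u).
Proof.
move=> hE; split; apply: tail_event_orth => //.
- by apply: continuous_measurable_fun; exact: continuous_cos.
- exact: cos_max.
- exact: cos_lipschitz.
- by move=> p q b c /(uncorrelated_trig_orth_shift gZ b c)[].
- by apply: continuous_measurable_fun; exact: continuous_sin.
- exact: sin_max.
- exact: sin_lipschitz.
- by move=> p q b c /(uncorrelated_trig_orth_shift gZ b c)[].
Qed.

(** The centered indicator of [E] is orthogonal to all linear combinations, hence to all
    finite-dimensional events, hence by approximation to [E] itself. This says
    [P E - P E ^ 2 = 0]. *)
Lemma tail_event_trivial (E : set T) : (forall n, approximable Z a n E) ->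
  P E = 0%E \/ P E = 1%E.
Proof.
move=> hE; have [mE hE0] := hE 0%N.
have bE := bmeas_indic R mE.
pose psi w : R := \1_E w - pr E.
have bpsi : bmeas psi by apply: bmeasB (bmeas_cst _ _).
have psi1 w : `|psi w| <= 1 by exact: norm_indic_subr_le1.
have : \int[P]_w (psi w * \1_E w) = 0.
  apply: eq0_of_small => e e0; have [N [B [hB EB]]] := hE0 e e0.
  pose F := threshold_event Z a B.
  have mF : measurable F by exact: measurable_threshold_event hB.
  have bF := bmeas_indic R mF.
  have F0 : \int[P]_w (psi w * \1_F w) = 0.
    apply: (trig_orth_tevent a mZ bpsi _ hB) => v _.
    exact: tail_event_trig_orth.
  rewrite -[X in `|X|]subr0 -F0 -Rintegral_bmeasB; [|exact: bmeasM..].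
  apply: le_trans (le_normr_Rintegral _ _) _ => //.
    by apply: bmeas_integrable; apply: bmeasB; exact: bmeasM.
  apply: (@le_trans _ _ e); last by rewrite ler_peMl ?(ltW e0)// ler1n.
  apply: le_trans EB; apply: le_Rintegral => //.
  - by apply: bmeas_integrable; apply: bmeas_norm; apply: bmeasB; exact: bmeasM.
  - by apply: bmeas_integrable; apply: bmeas_norm; exact: bmeasB.
  - by move=> w _; rewrite -mulrBr normrM ler_piMl.
have -> : \int[P]_w (psi w * \1_E w) = pr E - pr E * pr E.
  rewrite -Rintegral_bmeasZ// -Rintegral_bmeasB//; last exact: bmeasM (bmeas_cst _ _) _.
  apply: eq_Rintegral => w _; rewrite /psi mulrBl indicE.
  by case: (_ \in _); rewrite ?mulr1 ?mulr0.
rewrite -{1}[pr E]mulr1 -mulrBr => /eqP; rewrite mulf_eq0 subr_eq0 Rintegral_indicE//.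
have PE : P E = (fine (P E))%:E by rewrite fineK// fin_num_measure.
by move=> /orP[|] /eqP h; [left|right]; rewrite PE ?h// -h.
Qed.

End tail_orthogonality.

Theorem mainTheorem6 (R : realType) (d : measure_display)
  (T : measurableType d) (P : probability T R)
  (Z : nat -> {RV P >-> R}) (a : nat -> R) :
  gaussian_process Z ->
  negatively_associated P (threshold Z a) ->
  tail_trivial P (threshold Z a).
Proof.
move=> gZ NA E tE; apply: (tail_event_trivial (a := a) gZ).
  by move=> i j; exact: negatively_associated_cov_le0 NA.
by move=> n; apply: sigma_coord_gen_approximable; exact: tE.
Qed.
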